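(* In the Hilbert space $\ell_2$ with its usual norm $\|\cdot\|_2$ (and $\ell_2^*$ identified with $\ell_2$): (1) For every $\delta>0$ there exists a $C^1$ smooth Lipschitz function $\psi:\ell_2\to\mathbb{R}$ with Lipschitz derivative such that $\sup_{x\in\ell_2}|\psi(x)-\|x\|_2|\le\delta$, $\psi'(x)\neq0$ for all $x\in\ell_2$, and the cone $\mathcal{C}(\psi)$ has empty interior in $\ell_2$. (2) There exists a $C^1$ smooth Lipschitz bump function $b$ on $\ell_2$ with Lipschitz derivative such that $\mathcal{C}(b)$ has empty interior in $\ell_2$ and $b'(x)\neq0$ for every $x$ in the interior of the support of $b$.
   Context: For a differentiable function $f$ on a Banach space $X$, $\mathcal{C}(f)=\{\lambda f'(x): \lambda\ge0,\ x\in X\}\subseteq X^*$ is the cone generated by its set of derivatives. A bump function is a function not identically zero with bounded support, where the support is the closure of the set where it is nonzero. *)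

(* Defs.v *)
From Stdlib Require Import Reals.
From Coquelicot Require Import Coquelicot.
Open Scope R_scope.

Definition l2 (x : nat -> R) : Prop := ex_series (fun n => (x n) ^ 2).

Definition vadd (x y : nat -> R) : nat -> R := fun n => x n + y n.
Definition vsub (x y : nat -> R) : nat -> R := fun n => x n - y n.
Definition vscal (c : R) (x : nat -> R) : nat -> R := fun n => c * x n.
Definition vzero : nat -> R := fun _ => 0.

Definition inner (x y : nat -> R) : R := Series (fun n => x n * y n).
Definition norm2 (x : nat -> R) : R := sqrt (Series (fun n => (x n) ^ 2)).

(** Frechet derivative of f at x is g, where l_2^* is identified with l_2
    (Riesz): the functional h |-> <g, h>. *)
Definition is_frechet (f : (nat -> R) -> R) (x g : nat -> R) : Prop :=
  l2 g /\
  forall eps : R, 0 < eps -> exists d : R, 0 < d /\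
    forall h : nat -> R, l2 h -> norm2 h < d ->
      Rabs (f (vadd x h) - f x - inner g h) <= eps * norm2 h.

Definition lipschitz_fun (f : (nat -> R) -> R) : Prop :=
  exists L : R, forall x y, l2 x -> l2 y -> Rabs (f x - f y) <= L * norm2 (vsub x y).

Definition lipschitz_map (F : (nat -> R) -> (nat -> R)) : Prop :=
  exists L : R, forall x y, l2 x -> l2 y -> norm2 (vsub (F x) (F y)) <= L * norm2 (vsub x y).

Definition continuous_map (F : (nat -> R) -> (nat -> R)) : Prop :=
  forall x, l2 x -> forall eps, 0 < eps -> exists d, 0 < d /\
    forall y, l2 y -> norm2 (vsub y x) < d -> norm2 (vsub (F y) (F x)) < eps.

Definition C1_with_deriv (f : (nat -> R) -> R) (Df : (nat -> R) -> (nat -> R)) : Prop :=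
  (forall x, l2 x -> is_frechet f x (Df x)) /\ continuous_map Df.

(** Subsets of l_2 as predicates (only their l_2 members matter). *)
Definition l2_interior (S : (nat -> R) -> Prop) (x : nat -> R) : Prop :=
  l2 x /\ exists r, 0 < r /\ forall z, l2 z -> norm2 (vsub z x) < r -> S z.

Definition empty_interior (S : (nat -> R) -> Prop) : Prop :=
  forall x, ~ l2_interior S x.

Definition l2_closure (S : (nat -> R) -> Prop) (x : nat -> R) : Prop :=
  l2 x /\ forall eps, 0 < eps -> exists z, l2 z /\ S z /\ norm2 (vsub z x) < eps.

Definition cone (Df : (nat -> R) -> (nat -> R)) (z : nat -> R) : Prop :=
  exists lam x, 0 <= lam /\ l2 x /\ forall n, z n = vscal lam (Df x) n.

Definition support (f : (nat -> R) -> R) : (nat -> R) -> Prop :=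
  l2_closure (fun x => l2 x /\ f x <> 0).

Definition bounded_set (S : (nat -> R) -> Prop) : Prop :=
  exists M, forall x, S x -> norm2 x <= M.

Definition is_bump (f : (nat -> R) -> R) : Prop :=
  (exists x, l2 x /\ f x <> 0) /\ bounded_set (support f).

(* Main.v *)
(* The cone of a function misses every nonzero finitely supported sequence, hence has empty
   interior, as soon as every gradient is zero or has infinitely many nonzero coordinates.
   To obtain such gradients, split N into infinitely many infinite blocks and take on the
   k-th block a rescaled copy eta_k^2 G(x_k / eta_k) of a function G on l_2 without critical
   points, at bounded distance from |y|^2; if sum eta_k^2 is small, the sum over the blocks is
   close to |x|^2 and its gradient is nonzero in every block.  Its square root (after
   adding a constant) approximates the norm, and truncating that gives the bump.

   With p = |y|^2 and C = sum_j y_j y_(j+1), take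
     G(y) = p - 8 C / (1 + p) - (1 - p)_+^2 y_0 / 4.
   A critical point solves a homogeneous second order linear recurrence with constant
   coefficients for j >= 1; for p < 1 the spectral parameter lies inside the continuous
   spectrum of the shift, so that only y = 0 is square summable, and this is excluded by the
   linear term; for p >= 1 the linear term is absent and the boundary equation at j = 0
   forces y = 0.

   All regularity is derived from the global estimate
   |f(x + h) - f(x) - <Df(x), h>| <= M |h|^2, which already implies that Df is Lipschitz. *)
Require Import Defs.
From Stdlib Require Import Reals Lra Lia Psatz Cantor FunctionalExtensionality Classical.
From Coquelicot Require Import Coquelicot.
Open Scope R_scope.

(** * Series and the space l_2 *)

Lemma ex_series_Rplus (a b : nat -> R) :
  ex_series a -> ex_series b -> ex_series (fun n => a n + b n).
Proof. exact (ex_series_plus a b). Qed.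

Lemma ex_series_Rminus (a b : nat -> R) :
  ex_series a -> ex_series b -> ex_series (fun n => a n - b n).
Proof. exact (ex_series_minus a b). Qed.

Lemma ex_series_Rscal (c : R) (a : nat -> R) :
  ex_series a -> ex_series (fun n => c * a n).
Proof. exact (ex_series_scal c a). Qed.

Lemma ex_series_dominated (a b : nat -> R) :
  (forall n, Rabs (a n) <= b n) -> ex_series b -> ex_series a.
Proof. exact (@ex_series_le R_AbsRing R_CompleteNormedModule a b). Qed.

Lemma Series_nonneg (a : nat -> R) :
  (forall n, 0 <= a n) -> ex_series a -> 0 <= Series a.
Proof.
  intros Ha Hex.
  (* Zero is written with [0 * 0] so that [Series_scal_l] evaluates the constant series. *)
  replace 0 with (Series (fun _ : nat => 0 * 0)).
  - apply Series_le; [intros n; specialize (Ha n); lra | exact Hex].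
  - rewrite Series_scal_l. ring.
Qed.

Lemma Series_Rle (a b : nat -> R) :
  (forall n, a n <= b n) -> ex_series a -> ex_series b -> Series a <= Series b.
Proof.
  intros H Ha Hb.
  assert (0 <= Series (fun n => b n - a n)).
  { apply Series_nonneg; [intros n; specialize (H n); lra |].
    now apply ex_series_Rminus. }
  rewrite Series_minus in H0 by assumption. lra.
Qed.

Lemma Series_Rabs_le (a b : nat -> R) :
  (forall n, Rabs (a n) <= b n) -> ex_series b -> Rabs (Series a) <= Series b.
Proof.
  intros H Hb.
  assert (Ha : ex_series (fun n => Rabs (a n))).
  { apply ex_series_dominated with b; [intros n; rewrite Rabs_Rabsolu; apply H | exact Hb]. }
  eapply Rle_trans; [apply Series_Rabs, Ha |].
  now apply Series_Rle.
Qed.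

Lemma sum_n_le_Series (a : nat -> R) (N : nat) :
  (forall n, 0 <= a n) -> ex_series a -> sum_n a N <= Series a.
Proof.
  intros Ha Hex.
  apply (is_lim_seq_incr_compare (sum_n a) (Series a)).
  - exact (Series_correct _ Hex).
  - intros n. rewrite sum_Sn. unfold plus; simpl. specialize (Ha (S n)). lra.
Qed.

Lemma ex_series_bounded (a : nat -> R) (M : R) :
  (forall n, 0 <= a n) -> (forall N, sum_n a N <= M) -> ex_series a.
Proof.
  intros Ha HM.
  destruct (ex_finite_lim_seq_incr (sum_n a) M) as [l Hl].
  - intros n. rewrite sum_Sn. unfold plus; simpl. specialize (Ha (S n)). lra.
  - exact HM.
  - now exists l.
Qed.

Lemma Series_bounded (a : nat -> R) (M : R) :
  ex_series a -> (forall N, sum_n a N <= M) -> Series a <= M.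
Proof.
  intros Hex HM.
  apply (is_lim_seq_le (sum_n a) (fun _ => M) (Series a) M HM).
  - exact (Series_correct _ Hex).
  - apply is_lim_seq_const.
Qed.

Lemma is_series_finite (a : nat -> R) (N : nat) :
  (forall n, (N < n)%nat -> a n = 0) -> is_series a (sum_n a N).
Proof.
  intros Ha. change (is_lim_seq (sum_n a) (Finite (sum_n a N))).
  apply (is_lim_seq_ext_loc (fun _ => sum_n a N)); [| apply is_lim_seq_const].
  exists N. intros n Hn. induction Hn as [| n Hn IH]; [reflexivity |].
  rewrite sum_Sn, <- IH, Ha by lia. symmetry. apply Rplus_0_r.
Qed.

Lemma is_series_truncate (a : nat -> R) (N : nat) :
  is_series (fun n => if Nat.leb n N then a n else 0) (sum_n a N).
Proof.
  rewrite <- (sum_n_ext_loc (fun n => if Nat.leb n N then a n else 0) a N).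
  - apply is_series_finite. intros n Hn. destruct (Nat.leb_spec n N); [lia | reflexivity].
  - intros n Hn. destruct (Nat.leb_spec n N); [reflexivity | lia].
Qed.

(** * Vector operations, inner product and norm of l_2 *)

Lemma l2_mul (x y : nat -> R) : l2 x -> l2 y -> ex_series (fun n => x n * y n).
Proof.
  intros Hx Hy.
  apply ex_series_dominated with (fun n => (x n) ^ 2 + (y n) ^ 2).
  - intros n. apply Rabs_le. nra.
  - now apply ex_series_Rplus.
Qed.

Lemma l2_mul_abs (x y : nat -> R) :
  l2 x -> l2 y -> ex_series (fun n => Rabs (x n * y n)).
Proof.
  intros Hx Hy.
  apply ex_series_dominated with (fun n => (x n) ^ 2 + (y n) ^ 2).
  - intros n. rewrite Rabs_Rabsolu. apply Rabs_le. nra.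
  - now apply ex_series_Rplus.
Qed.

Lemma l2_vadd (x y : nat -> R) : l2 x -> l2 y -> l2 (vadd x y).
Proof.
  intros Hx Hy.
  apply ex_series_ext with (fun n => ((x n) ^ 2 + (y n) ^ 2) + 2 * (x n * y n)).
  - intros n. unfold vadd. simpl. ring.
  - apply ex_series_Rplus; [now apply ex_series_Rplus |].
    now apply ex_series_Rscal, l2_mul.
Qed.

Lemma l2_vscal (c : R) (x : nat -> R) : l2 x -> l2 (vscal c x).
Proof.
  intros Hx.
  apply ex_series_ext with (fun n => c ^ 2 * (x n) ^ 2).
  - intros n. unfold vscal. simpl. ring.
  - now apply ex_series_Rscal.
Qed.

Lemma vsub_vadd (x y : nat -> R) : vsub x y = vadd x (vscal (-1) y).
Proof. apply functional_extensionality; intros n. unfold vsub, vadd, vscal. ring. Qed.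

Lemma l2_vsub (x y : nat -> R) : l2 x -> l2 y -> l2 (vsub x y).
Proof. intros Hx Hy. rewrite vsub_vadd. now apply l2_vadd; [| apply l2_vscal]. Qed.

Lemma inner_vaddr (x y z : nat -> R) :
  l2 x -> l2 y -> l2 z -> inner x (vadd y z) = inner x y + inner x z.
Proof.
  intros Hx Hy Hz. unfold inner, vadd.
  rewrite <- Series_plus by now apply l2_mul.
  apply Series_ext. intros n. ring.
Qed.

Lemma inner_sym (x y : nat -> R) : inner x y = inner y x.
Proof. apply Series_ext. intros n. ring. Qed.

Lemma inner_vscalr (c : R) (x y : nat -> R) : inner x (vscal c y) = c * inner x y.
Proof.
  unfold inner, vscal. rewrite <- Series_scal_l.
  apply Series_ext. intros n. ring.
Qed.

Lemma inner_vscall (c : R) (x y : nat -> R) : inner (vscal c x) y = c * inner x y.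
Proof. now rewrite inner_sym, inner_vscalr, inner_sym. Qed.

Lemma inner_vaddl (x y z : nat -> R) :
  l2 x -> l2 y -> l2 z -> inner (vadd x y) z = inner x z + inner y z.
Proof.
  intros Hx Hy Hz. rewrite inner_sym, inner_vaddr by assumption.
  now rewrite (inner_sym z x), (inner_sym z y).
Qed.

Lemma norm2_nonneg (x : nat -> R) : 0 <= norm2 x.
Proof. apply sqrt_pos. Qed.

Lemma norm2_sq (x : nat -> R) : l2 x -> norm2 x ^ 2 = inner x x.
Proof.
  intros Hx. unfold norm2. rewrite pow2_sqrt.
  - apply Series_ext. intros n. ring.
  - apply Series_nonneg; [intros n; apply pow2_ge_0 | exact Hx].
Qed.

Lemma norm2_vadd_sq (x y : nat -> R) : l2 x -> l2 y ->
  norm2 (vadd x y) ^ 2 = norm2 x ^ 2 + 2 * inner x y + norm2 y ^ 2.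
Proof.
  intros Hx Hy.
  rewrite !norm2_sq by (try apply l2_vadd; assumption).
  rewrite inner_vaddl, !inner_vaddr by (try apply l2_vadd; assumption).
  rewrite (inner_sym y x). ring.
Qed.

Lemma norm2_vscal (c : R) (x : nat -> R) : norm2 (vscal c x) = Rabs c * norm2 x.
Proof.
  unfold norm2.
  rewrite (Series_ext _ (fun n => c² * (x n) ^ 2)).
  - rewrite Series_scal_l, sqrt_mult_alt by apply Rle_0_sqr.
    now rewrite sqrt_Rsqr_abs.
  - intros n. unfold vscal, Rsqr. ring.
Qed.

Lemma cauchy_schwarz (x y : nat -> R) :
  l2 x -> l2 y -> Rabs (inner x y) <= norm2 x * norm2 y.
Proof.
  intros Hx Hy.
  pose proof (norm2_nonneg x) as nx. pose proof (norm2_nonneg y) as ny.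
  assert (H : forall t, 0 <= norm2 x ^ 2 + 2 * (t * inner x y) + t ^ 2 * norm2 y ^ 2).
  { intros t.
    pose proof (norm2_vadd_sq x (vscal t y) Hx (l2_vscal t y Hy)) as E.
    rewrite inner_vscalr, norm2_vscal, Rpow_mult_distr, pow2_abs in E.
    rewrite <- E. apply pow2_ge_0. }
  assert (Hsq : inner x y ^ 2 <= (norm2 x * norm2 y) ^ 2).
  { destruct (Req_dec (norm2 y) 0) as [E | E].
    - destruct (Req_dec (inner x y) 0) as [-> | E']; [rewrite E; lra |].
      (* When [norm2 y = 0] the polynomial in [t] is affine with nonzero slope; at this [t] it
         equals [-1]. *)
      specialize (H (- (norm2 x ^ 2 + 1) / (2 * inner x y))).
      replace (- (norm2 x ^ 2 + 1) / (2 * inner x y) * inner x y)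
        with (- (norm2 x ^ 2 + 1) / 2) in H by (field; exact E').
      rewrite E in H. lra.
    (* This [t] is the minimiser of the quadratic polynomial. *)
    - specialize (H (- inner x y / norm2 y ^ 2)).
      assert (Hy2 : 0 < norm2 y ^ 2) by (apply pow2_gt_0; lra).
      replace (norm2 x ^ 2 + 2 * (- inner x y / norm2 y ^ 2 * inner x y)
               + (- inner x y / norm2 y ^ 2) ^ 2 * norm2 y ^ 2)
        with (norm2 x ^ 2 - inner x y ^ 2 / norm2 y ^ 2) in H by (field; lra).
      assert (inner x y ^ 2 / norm2 y ^ 2 * norm2 y ^ 2 = inner x y ^ 2) by (field; lra).
      nra. }
  rewrite <- (Rabs_pos_eq (norm2 x * norm2 y)) by nra.
  apply Rsqr_le_abs_0. unfold Rsqr. lra.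
Qed.

Lemma norm2_triangle (x y : nat -> R) :
  l2 x -> l2 y -> norm2 (vadd x y) <= norm2 x + norm2 y.
Proof.
  intros Hx Hy.
  pose proof (norm2_vadd_sq x y Hx Hy). pose proof (cauchy_schwarz x y Hx Hy).
  pose proof (norm2_nonneg x). pose proof (norm2_nonneg y).
  pose proof (Rle_abs (inner x y)).
  apply Rsqr_incr_0_var; [unfold Rsqr; nra | lra].
Qed.

Lemma norm2_opp (x : nat -> R) : norm2 (vscal (-1) x) = norm2 x.
Proof. rewrite norm2_vscal, Rabs_left by lra. ring. Qed.

Lemma norm2_vsub_sym (x y : nat -> R) : norm2 (vsub x y) = norm2 (vsub y x).
Proof.
  rewrite <- (norm2_opp (vsub x y)). f_equal.
  apply functional_extensionality; intros n. unfold vscal, vsub. ring.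
Qed.

Lemma vadd_vsub (x y : nat -> R) : vadd x (vsub y x) = y.
Proof. apply functional_extensionality; intros n. unfold vadd, vsub. ring. Qed.

Lemma vsub_vadd_cancel (x h : nat -> R) : vsub (vadd x h) x = h.
Proof. apply functional_extensionality; intros n. unfold vadd, vsub. ring. Qed.

Lemma norm2_vsub_le (x y : nat -> R) :
  l2 x -> l2 y -> norm2 (vsub x y) <= norm2 x + norm2 y.
Proof.
  intros Hx Hy. rewrite vsub_vadd, <- (norm2_opp y).
  apply norm2_triangle; [| apply l2_vscal]; assumption.
Qed.

(** * Quadratic approximation *)

(** The estimate is required for all increments, not only small ones, so that replacing [f] by
    [c ^ 2 * f (x / c)] preserves the constant [M]. *)
Definition quadratic_approx (f : (nat -> R) -> R) (D : (nat -> R) -> nat -> R) (M : R) :=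
  0 <= M /\
  forall x, l2 x -> l2 (D x) /\
    forall h, l2 h -> Rabs (f (vadd x h) - f x - inner (D x) h) <= M * norm2 h ^ 2.

Lemma quadratic_approx_frechet f D M x :
  quadratic_approx f D M -> l2 x -> is_frechet f x (D x).
Proof.
  intros [HM H] Hx. destruct (H x Hx) as [HD Hq]. split; [exact HD |].
  (* The [+ 1] keeps the denominator positive when [M = 0]. *)
  intros eps Heps. exists (eps / (M + 1)). split; [apply Rdiv_lt_0_compat; lra |].
  intros h Hh Hsmall. eapply Rle_trans; [apply Hq, Hh |].
  pose proof (norm2_nonneg h).
  apply Rmult_lt_compat_r with (r := M + 1) in Hsmall; [| lra].
  replace (eps / (M + 1) * (M + 1)) with eps in Hsmall by (field; lra).
  nra.
Qed.

(* Test the three Taylor estimates between x, y = x + d and y + h on an h parallel to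
   D y - D x and of the length of d. *)
Lemma quadratic_approx_lipschitz_map f D M x y :
  quadratic_approx f D M -> l2 x -> l2 y ->
  norm2 (vsub (D x) (D y)) <= 6 * M * norm2 (vsub x y).
Proof.
  intros [HM H] Hx Hy.
  destruct (H x Hx) as [HDx Hqx]. destruct (H y Hy) as [HDy Hqy].
  set (d := vsub y x). set (w := vsub (D y) (D x)).
  assert (Hd : l2 d) by now apply l2_vsub.
  assert (Hw : l2 w) by now apply l2_vsub.
  rewrite (norm2_vsub_sym (D x)), (norm2_vsub_sym x). fold d w.
  pose proof (norm2_nonneg d) as nd. pose proof (norm2_nonneg w) as nw.
  destruct (Req_dec (norm2 w) 0) as [E | E]; [rewrite E; nra |].
  assert (Key : forall r, 0 <= r ->
    norm2 w * r <= M * (norm2 d ^ 2 + (norm2 d + r) ^ 2 + r ^ 2)).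
  { intros r Hr. set (h := vscal (r / norm2 w) w).
    assert (Hh : l2 h) by now apply l2_vscal.
    assert (Nh : norm2 h = r).
    { unfold h. rewrite norm2_vscal, Rabs_pos_eq; [field; exact E |].
      apply Rdiv_le_0_compat; lra. }
    assert (Iw : inner w h = norm2 w * r).
    { unfold h. rewrite inner_vscalr, <- norm2_sq by exact Hw. field. exact E. }
    assert (Iw' : inner w h = inner (D y) h - inner (D x) h).
    { unfold w. rewrite vsub_vadd, inner_vaddl, inner_vscall
        by (try apply l2_vscal; assumption). ring. }
    assert (E1 : vadd x d = y) by apply vadd_vsub.
    assert (E2 : vadd x (vadd d h) = vadd y h).
    { rewrite <- E1. apply functional_extensionality; intros n. unfold vadd. ring. }
    pose proof (Hqx d Hd) as T1. rewrite E1 in T1.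
    pose proof (Hqx (vadd d h) (l2_vadd _ _ Hd Hh)) as T2.
    rewrite E2, inner_vaddr in T2 by assumption.
    pose proof (Hqy h Hh) as T3. rewrite Nh in T3.
    assert (T4 : norm2 (vadd d h) ^ 2 <= (norm2 d + r) ^ 2).
    { pose proof (norm2_triangle d h Hd Hh). pose proof (norm2_nonneg (vadd d h)).
      apply pow_incr. lra. }
    apply Rabs_le_between in T1, T2, T3.
    assert (M * norm2 (vadd d h) ^ 2 <= M * (norm2 d + r) ^ 2)
      by now apply Rmult_le_compat_l.
    lra. }
  destruct (Req_dec (norm2 d) 0) as [E' | E'].
  (* With [d] of norm zero, [Key] reads [norm2 w * r <= 2 * M * r ^ 2], which fails for small
     positive [r]. *)
  - exfalso. rewrite E' in Key.
    assert (Hr : 0 < norm2 w / (4 * M + 1)) by (apply Rdiv_lt_0_compat; lra).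
    specialize (Key _ (Rlt_le _ _ Hr)). set (r := norm2 w / (4 * M + 1)) in *.
    assert (norm2 w = (4 * M + 1) * r) by (unfold r; field; lra).
    nra.
  (* For [r = norm2 d] the three squares add up to [6 * norm2 d ^ 2], whence the factor 6. *)
  - specialize (Key _ nd).
    apply Rmult_le_reg_r with (norm2 d); [lra |]. nra.
Qed.

(* Take [h] to be a negative multiple of a truncation of [Dx]; this works before one knows
   that [Dx] is square summable. *)
Lemma nonneg_gradient_bound (f : (nat -> R) -> R) (x Dx : nat -> R) (M : R) :
  0 < M -> l2 x -> (forall y, l2 y -> 0 <= f y) ->
  (forall h, l2 h -> ex_series (fun n => Rabs (Dx n * h n)) ->
     f (vadd x h) - f x - inner Dx h <= M * norm2 h ^ 2) ->
  l2 Dx /\ norm2 Dx ^ 2 <= 4 * M * f x.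
Proof.
  intros HM Hx Hf H.
  assert (Hbound : forall N, sum_n (fun n => Dx n ^ 2) N <= 4 * M * f x).
  { intros N.
    set (t := fun n => if Nat.leb n N then Dx n else 0).
    assert (Ht : forall n, Dx n * t n = t n ^ 2 /\
                           t n ^ 2 = if Nat.leb n N then Dx n ^ 2 else 0).
    { intros n. unfold t. destruct (Nat.leb n N); split; ring. }
    pose proof (is_series_truncate (fun n => Dx n ^ 2) N) as Ht2.
    apply (is_series_ext _ (fun n => t n ^ 2)) in Ht2; [| intros n; symmetry; apply Ht].
    assert (Lt : l2 t) by (eexists; exact Ht2).
    assert (Hdt : inner Dx t = sum_n (fun n => Dx n ^ 2) N).
    { rewrite <- (is_series_unique _ _ Ht2). apply Series_ext. intros n. apply Ht. }
    assert (Nt : norm2 t ^ 2 = sum_n (fun n => Dx n ^ 2) N).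
    { rewrite norm2_sq by exact Lt. rewrite <- (is_series_unique _ _ Ht2).
      apply Series_ext. intros n. ring. }
    set (S := sum_n (fun n => Dx n ^ 2) N : R) in *.
    (* Along [s * t] the upper bound for [f] is [f x + s * S + M * s ^ 2 * S]; its minimum, at
       [s = - / (2 * M)], is [f x - S / (4 * M)]. *)
    specialize (H (vscal (- / (2 * M)) t) (l2_vscal _ _ Lt)).
    rewrite inner_vscalr, Hdt, norm2_vscal, Rpow_mult_distr, pow2_abs, Nt in H.
    specialize (Hf (vadd x (vscal (- / (2 * M)) t))
                  (l2_vadd _ _ Hx (l2_vscal _ _ Lt))).
    assert (Hq : M * ((- / (2 * M)) ^ 2 * S) = S / (4 * M)) by (field; lra).
    assert (Hq' : - / (2 * M) * S = - 2 * (S / (4 * M))) by (field; lra).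
    rewrite Hq, Hq' in H.
    assert (S = 4 * M * (S / (4 * M))) by (field; lra).
    assert (S / (4 * M) <= f x).
    { enough (ex_series (fun n => Rabs (Dx n * vscal (- / (2 * M)) t n))) by
        (specialize (H H1); lra).
      apply ex_series_ext with (fun n => / (2 * M) * t n ^ 2).
      - intros n. unfold vscal. rewrite <- (proj1 (Ht n)).
        replace (Dx n * (- / (2 * M) * t n)) with (- (/ (2 * M) * (Dx n * t n))) by ring.
        rewrite Rabs_Ropp, Rabs_pos_eq; [reflexivity |].
        rewrite (proj1 (Ht n)). apply Rmult_le_pos; [| apply pow2_ge_0].
        left. apply Rinv_0_lt_compat. lra.
      - apply ex_series_Rscal. exact Lt. }
    nra. }
  assert (HD : l2 Dx).
  { apply ex_series_bounded with (4 * M * f x); [| exact Hbound].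
    intros n. apply pow2_ge_0. }
  split; [exact HD |].
  rewrite norm2_sq by exact HD.
  apply Series_bounded; [now apply l2_mul |].
  intros N. erewrite sum_n_ext; [apply Hbound |]. intros n; simpl. ring.
Qed.

(** * A function without critical points *)

Definition cut (p : R) : R := Rmax 0 (1 - p).

(* Here and below [n], [n1], [m] are the norms of [y], [y + h], [h]; [a] is the linear part of
   the increment of the squared norm, [c] and [Q] are the linear and quadratic parts of that of
   the correlation [C], and [l], [l'] are the zeroth coordinates of [y], [h]. *)
Lemma quotient_remainder (n n1 m C c Q a : R) :
  0 <= n -> 0 <= n1 -> 0 <= m -> n1 <= n + m -> n <= n1 + m ->
  n1 ^ 2 = n ^ 2 + a + m ^ 2 -> Rabs a <= 2 * n * m ->
  Rabs C <= n ^ 2 -> Rabs c <= 2 * n * m -> Rabs Q <= m ^ 2 ->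
  Rabs ((C + c + Q) / (1 + n1 ^ 2) - C / (1 + n ^ 2)
        - (c / (1 + n ^ 2) - C * a / (1 + n ^ 2) ^ 2)) <= 7 * m ^ 2.
Proof.
  intros Hn Hn1 Hm T1 T2 Hp Ha HC Hc HQ.
  set (q := 1 + n ^ 2). set (q1 := 1 + n1 ^ 2).
  assert (Hq : 1 <= q) by (unfold q; nra). assert (Hq1 : 1 <= q1) by (unfold q1; nra).
  assert (Ea : a + m ^ 2 = q1 - q) by (unfold q, q1; lra).
  (* The remainder splits into three terms, bounded by 1, 1 and 5 times [m ^ 2]; the last is a
     product of two first order increments. *)
  replace ((C + c + Q) / q1 - C / q - (c / q - C * a / q ^ 2))
    with (Q / q1 - C * m ^ 2 / (q * q1) - (c * q - C * a) * (q1 - q) / (q ^ 2 * q1)).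
  2:{ rewrite <- Ea. replace a with (q1 - q - m ^ 2) by lra. field. lra. }
  assert (B1 : Rabs (Q / q1) <= m ^ 2).
  { unfold Rdiv. rewrite Rabs_mult, (Rabs_pos_eq (/ q1))
      by (left; apply Rinv_0_lt_compat; lra).
    apply Rle_trans with (m ^ 2 * 1); [| lra].
    apply Rmult_le_compat; [apply Rabs_pos | left; apply Rinv_0_lt_compat; lra | exact HQ |].
    rewrite <- Rinv_1. apply Rinv_le_contravar; lra. }
  assert (B2 : Rabs (C * m ^ 2 / (q * q1)) <= m ^ 2).
  { unfold Rdiv. rewrite Rabs_mult, Rabs_mult, (Rabs_pos_eq (m ^ 2)) by apply pow2_ge_0.
    rewrite (Rabs_pos_eq (/ (q * q1))) by (left; apply Rinv_0_lt_compat; nra).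
    apply Rmult_le_reg_r with (q * q1); [nra |].
    rewrite Rmult_assoc, Rinv_l, Rmult_1_r by nra.
    rewrite Rmult_comm. apply Rmult_le_compat_l; [nra |]. unfold q in *. nra. }
  assert (B3 : Rabs ((c * q - C * a) * (q1 - q) / (q ^ 2 * q1)) <= 5 * m ^ 2).
  { assert (G1 : Rabs (c * q - C * a) <= 4 * (n * m * q)).
    { unfold Rminus. eapply Rle_trans; [apply Rabs_triang |].
      rewrite Rabs_Ropp, !Rabs_mult, (Rabs_pos_eq q) by lra.
      assert (Rabs C * Rabs a <= q * (2 * n * m)).
      { apply Rmult_le_compat; try apply Rabs_pos; [unfold q; lra | exact Ha]. }
      assert (Rabs c * q <= 2 * n * m * q) by (apply Rmult_le_compat_r; lra).
      lra. }
    assert (G2 : Rabs (q1 - q) <= (n1 + n) * m).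
    { replace (q1 - q) with ((n1 + n) * (n1 - n)) by (unfold q, q1; ring).
      rewrite Rabs_mult, (Rabs_pos_eq (n1 + n)) by lra.
      apply Rmult_le_compat_l; [lra |]. apply Rabs_le. lra. }
    unfold Rdiv. rewrite !Rabs_mult.
    assert (Hqq : 0 < q ^ 2 * q1) by (apply Rmult_lt_0_compat; nra).
    rewrite (Rabs_pos_eq (/ (q ^ 2 * q1))) by (left; now apply Rinv_0_lt_compat).
    apply Rmult_le_reg_r with (q ^ 2 * q1); [exact Hqq |].
    rewrite Rmult_assoc, Rinv_l, Rmult_1_r by lra.
    apply Rle_trans with (4 * (n * m * q) * ((n1 + n) * m)).
    { apply Rmult_le_compat; try apply Rabs_pos; assumption. }
    replace (4 * (n * m * q) * ((n1 + n) * m)) with (m ^ 2 * q * (4 * (n * n1 + n ^ 2))) by ring.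
    replace (5 * m ^ 2 * (q ^ 2 * q1)) with (m ^ 2 * q * (5 * (q * q1))) by ring.
    apply Rmult_le_compat_l; [nra |].
    assert (4 * (n * n1) <= q * q1).
    { replace (4 * (n * n1)) with ((2 * n) * (2 * n1)) by ring.
      pose proof (pow2_ge_0 (n - 1)). pose proof (pow2_ge_0 (n1 - 1)).
      apply Rmult_le_compat; unfold q, q1; lra. }
    assert (n ^ 2 <= q * q1).
    { apply Rle_trans with (q * 1); [unfold q; lra | apply Rmult_le_compat_l; lra]. }
    lra. }
  apply Rabs_le_between in B1, B2, B3. apply Rabs_le. lra.
Qed.

(** The function [cut p ^ 2 * l] vanishes to second order on the unit sphere: an increment crossing
    the sphere meets only values of [cut] up to [2 * m]. When both points lie inside the ball, the
    remainder is a polynomial expression with bounded factors. *)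
Lemma cutoff_remainder (n n1 m a l l' : R) :
  0 <= n -> 0 <= n1 -> 0 <= m -> n1 <= n + m -> n <= n1 + m ->
  n1 ^ 2 = n ^ 2 + a + m ^ 2 -> Rabs a <= 2 * n * m ->
  Rabs l <= n -> Rabs l' <= m -> Rabs (l + l') <= n1 ->
  Rabs (cut (n1 ^ 2) ^ 2 * (l + l') - cut (n ^ 2) ^ 2 * l
        - (- 2 * cut (n ^ 2) * a * l + cut (n ^ 2) ^ 2 * l')) <= 16 * m ^ 2.
Proof.
  intros Hn Hn1 Hm T1 T2 Hp Ha Hl Hl' Hll.
  assert (prod : forall u v U V, Rabs u <= U -> Rabs v <= V -> Rabs (u * v) <= U * V).
  { intros u v U V Hu Hv. rewrite Rabs_mult.
    apply Rmult_le_compat; try apply Rabs_pos; assumption. }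
  destruct (Rle_or_lt 1 n) as [Bn | Bn].
  - replace (cut (n ^ 2)) with 0 by (unfold cut; rewrite Rmax_left; nra).
    replace (cut (n1 ^ 2) ^ 2 * (l + l') - 0 ^ 2 * l - (-2 * 0 * a * l + 0 ^ 2 * l'))
      with (cut (n1 ^ 2) ^ 2 * (l + l')) by ring.
    destruct (Rle_or_lt 1 n1) as [Bn1 | Bn1].
    + replace (cut (n1 ^ 2)) with 0 by (unfold cut; rewrite Rmax_left; nra).
      rewrite pow_ne_zero, Rmult_0_l, Rabs_R0 by lia. nra.
    + assert (Hs : 0 <= cut (n1 ^ 2) <= 2 * m).
      { unfold cut. rewrite Rmax_right by nra. nra. }
      apply Rle_trans with (4 * m ^ 2 * n1); [apply prod |]; [| exact Hll | nra].
      rewrite Rabs_pos_eq by nra. nra.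
  - assert (Es : cut (n ^ 2) = 1 - n ^ 2) by (unfold cut; rewrite Rmax_right; nra).
    rewrite Es.
    destruct (Rle_or_lt 1 n1) as [Bn1 | Bn1].
    + replace (cut (n1 ^ 2)) with 0 by (unfold cut; rewrite Rmax_left; nra).
      set (s := 1 - n ^ 2).
      assert (Hs : 0 <= s <= 2 * m) by (unfold s; nra).
      assert (Hs1 : s <= 1) by (unfold s; nra).
      replace (0 ^ 2 * (l + l') - s ^ 2 * l - (-2 * s * a * l + s ^ 2 * l'))
        with ((- s ^ 2 + 2 * s * a) * l - s ^ 2 * l') by ring.
      assert (A1 : Rabs (2 * s * a) <= 8 * m ^ 2).
      { apply Rle_trans with (2 * s * (2 * n * m)).
        - apply prod; [rewrite Rabs_pos_eq; lra | exact Ha].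
        - assert (0 <= s * n <= 2 * m) by nra. nra. }
      assert (A2 : Rabs ((- s ^ 2 + 2 * s * a) * l) <= 12 * m ^ 2 * 1).
      { apply prod; [| lra]. apply Rabs_le_between in A1. apply Rabs_le. nra. }
      assert (A3 : Rabs (s ^ 2 * l') <= s * m).
      { apply prod; [rewrite Rabs_pos_eq; nra | exact Hl']. }
      assert (s * m <= 2 * m ^ 2) by nra.
      apply Rabs_le_between in A2, A3. apply Rabs_le. lra.
    + replace (cut (n1 ^ 2)) with (1 - n1 ^ 2) by (unfold cut; rewrite Rmax_right; nra).
      set (d := n1 ^ 2 - n ^ 2).
      assert (Hd : Rabs d <= 2 * m).
      { replace d with ((n1 + n) * (n1 - n)) by (unfold d; ring).
        apply prod; [rewrite Rabs_pos_eq; lra | apply Rabs_le; lra]. }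
      (* Substituting [a = d - m ^ 2] displays the remainder as terms in [d ^ 2], [m ^ 2] and
         [d * l'], all of second order. *)
      replace ((1 - n1 ^ 2) ^ 2 * (l + l') - (1 - n ^ 2) ^ 2 * l
               - (-2 * (1 - n ^ 2) * a * l + (1 - n ^ 2) ^ 2 * l'))
        with ((d * d - 2 * (1 - n ^ 2) * m ^ 2) * l
              + d * (- (1 - n ^ 2) - (1 - n1 ^ 2)) * l')
        by (unfold d; replace a with (n1 ^ 2 - n ^ 2 - m ^ 2) by lra; ring).
      assert (A0 : Rabs (d * d) <= 2 * m * (2 * m)) by (apply prod; exact Hd).
      assert (A1 : Rabs ((d * d - 2 * (1 - n ^ 2) * m ^ 2) * l) <= 6 * m ^ 2 * 1).
      { apply prod; [| lra].
        assert (0 <= n ^ 2 * m ^ 2 <= m ^ 2).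
        { assert (0 <= n ^ 2 <= 1) by nra. pose proof (pow2_ge_0 m). nra. }
        pose proof (Rle_0_sqr d) as A3. unfold Rsqr in A3.
        apply Rabs_le_between in A0. apply Rabs_le. lra. }
      assert (A2 : Rabs (d * (- (1 - n ^ 2) - (1 - n1 ^ 2)) * l') <= 2 * m * 2 * m).
      { apply prod; [| exact Hl']. apply prod; [exact Hd |]. apply Rabs_le. nra. }
      apply Rabs_le_between in A1, A2. apply Rabs_le. nra.
Qed.

(** * The function [rolle], its gradient and its Taylor estimate *)

Definition shiftl (y : nat -> R) : nat -> R := fun j => y (S j).
Definition shiftr (y : nat -> R) : nat -> R :=
  fun j => match j with O => 0 | S i => y i end.
Definition e0 : nat -> R := fun j => match j with O => 1 | S _ => 0 end.
Definition corr (y : nat -> R) : R := inner y (shiftl y).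

(* The constants make the coefficient of [y] in [Drolle y] smaller in absolute value than twice
   the coefficient [8 / (1 + p)] of the shifts whenever [p < 1]. *)
Definition rolle (y : nat -> R) : R :=
  norm2 y ^ 2 - 8 * (corr y / (1 + norm2 y ^ 2)) - / 4 * (cut (norm2 y ^ 2) ^ 2 * y O).

(** The gradient of [corr] at [y] is [shiftl y + shiftr y]. In the coefficient of [y], the last two
    terms come from differentiating [p] in the quotient and in the cutoff. *)
Definition Drolle (y : nat -> R) : nat -> R :=
  let p := norm2 y ^ 2 in
  vadd (vscal (2 + 16 * corr y / (1 + p) ^ 2 + cut p * y O) y)
       (vadd (vscal (- (8 / (1 + p))) (vadd (shiftl y) (shiftr y)))
             (vscal (- (cut p ^ 2 / 4)) e0)).

Lemma l2_shiftl y : l2 y -> l2 (shiftl y).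
Proof. intros Hy. exact (proj1 (ex_series_incr_1 (fun n => y n ^ 2)) Hy). Qed.

Lemma l2_shiftr y : l2 y -> l2 (shiftr y).
Proof. intros Hy. apply (ex_series_incr_1 (fun n => shiftr y n ^ 2)). exact Hy. Qed.

Lemma l2_e0 : l2 e0.
Proof.
  apply (ex_series_incr_1 (fun n => e0 n ^ 2)).
  apply ex_series_ext with (fun n => 0 * (/ 2) ^ n).
  - intros n. simpl. ring.
  - apply ex_series_Rscal. eexists. apply is_series_geom. rewrite Rabs_pos_eq; lra.
Qed.

#[local] Hint Resolve l2_vadd l2_vscal l2_shiftl l2_shiftr l2_e0 : l2.

Lemma inner_e0 y : l2 y -> inner e0 y = y O.
Proof.
  intros Hy. unfold inner. rewrite Series_incr_1 by (apply l2_mul; [apply l2_e0 | exact Hy]).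
  simpl. rewrite Series_scal_l. ring.
Qed.

Lemma norm2_shiftl y : l2 y -> norm2 (shiftl y) ^ 2 = norm2 y ^ 2 - y O ^ 2.
Proof.
  intros Hy. rewrite !norm2_sq by (try apply l2_shiftl; exact Hy).
  unfold inner at 2. rewrite Series_incr_1 by now apply l2_mul.
  unfold inner, shiftl. ring.
Qed.

Lemma norm2_shiftl_le y : l2 y -> norm2 (shiftl y) <= norm2 y.
Proof.
  intros Hy. pose proof (norm2_shiftl y Hy). pose proof (norm2_nonneg y).
  apply Rsqr_incr_0_var; [unfold Rsqr; nra | lra].
Qed.

Lemma Rabs_coord0_le y : l2 y -> Rabs (y O) <= norm2 y.
Proof.
  intros Hy. pose proof (norm2_shiftl y Hy). pose proof (pow2_ge_0 (norm2 (shiftl y))).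
  rewrite <- (Rabs_pos_eq (norm2 y)) by apply norm2_nonneg.
  apply Rsqr_le_abs_0. unfold Rsqr. lra.
Qed.

Lemma inner_shiftr y h : l2 y -> l2 h -> inner (shiftr y) h = inner y (shiftl h).
Proof.
  intros Hy Hh. unfold inner.
  rewrite Series_incr_1 by (apply l2_mul; [apply l2_shiftr |]; assumption).
  simpl. unfold shiftl. ring.
Qed.

Lemma inner_shiftl_le y h : l2 y -> l2 h -> Rabs (inner y (shiftl h)) <= norm2 y * norm2 h.
Proof.
  intros Hy Hh.
  eapply Rle_trans; [apply cauchy_schwarz; [| apply l2_shiftl]; assumption |].
  apply Rmult_le_compat_l; [apply norm2_nonneg | now apply norm2_shiftl_le].
Qed.

Lemma corr_le y : l2 y -> Rabs (corr y) <= norm2 y ^ 2.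
Proof. intros Hy. pose proof (inner_shiftl_le y y Hy Hy). unfold corr. lra. Qed.

Lemma corr_vadd y h : l2 y -> l2 h ->
  corr (vadd y h) = corr y + (inner (shiftl y) h + inner y (shiftl h)) + corr h.
Proof.
  intros Hy Hh. unfold corr.
  change (shiftl (vadd y h)) with (vadd (shiftl y) (shiftl h)).
  pose proof (l2_shiftl _ Hy). pose proof (l2_shiftl _ Hh).
  rewrite inner_vaddl, 2 inner_vaddr by (try apply l2_vadd; assumption).
  rewrite (inner_sym (shiftl y) h). ring.
Qed.

Lemma l2_Drolle y : l2 y -> l2 (Drolle y).
Proof.
  intros Hy. unfold Drolle. auto 10 with l2.
Qed.

Lemma inner_Drolle y h : l2 y -> l2 h ->
  inner (Drolle y) h =
  (2 + 16 * corr y / (1 + norm2 y ^ 2) ^ 2 + cut (norm2 y ^ 2) * y O) * inner y h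
  - 8 / (1 + norm2 y ^ 2) * (inner (shiftl y) h + inner y (shiftl h))
  - cut (norm2 y ^ 2) ^ 2 / 4 * h O.
Proof.
  intros Hy Hh. unfold Drolle.
  rewrite inner_vaddl, inner_vscall, inner_vaddl, !inner_vscall, inner_vaddl
    by auto 10 with l2.
  rewrite inner_e0, inner_shiftr by assumption. ring.
Qed.

(** The constant is [1 + 8 * 7 + 16 / 4]: the squared norm has remainder exactly [norm2 h ^ 2], and
    the other two terms enter [rolle] with weights 8 and [/ 4]. *)
Lemma rolle_quadratic_approx : quadratic_approx rolle Drolle 61.
Proof.
  split; [lra |]. intros y Hy. split; [now apply l2_Drolle |]. intros h Hh.
  rewrite inner_Drolle by assumption. unfold rolle.
  pose proof (norm2_nonneg y) as n0. pose proof (norm2_nonneg h) as m0.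
  pose proof (l2_vadd _ _ Hy Hh) as Hyh. pose proof (norm2_nonneg (vadd y h)) as n10.
  pose proof (norm2_vadd_sq y h Hy Hh) as E.
  pose proof (norm2_triangle y h Hy Hh) as T1.
  pose proof (norm2_vsub_le (vadd y h) h Hyh Hh) as T2.
  replace (vsub (vadd y h) h) with y in T2
    by (apply functional_extensionality; intros i; unfold vsub, vadd; ring).
  pose proof (cauchy_schwarz y h Hy Hh) as CS.
  pose proof (corr_le y Hy) as Cy. pose proof (corr_le h Hh) as Ch.
  pose proof (inner_shiftl_le y h Hy Hh) as S1. pose proof (inner_shiftl_le h y Hh Hy) as S2.
  rewrite (inner_sym h) in S2.
  pose proof (Rabs_coord0_le y Hy) as L1. pose proof (Rabs_coord0_le h Hh) as L2.
  pose proof (Rabs_coord0_le _ Hyh) as L3. unfold vadd at 1 in L3.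
  rewrite corr_vadd by assumption.
  set (c := inner (shiftl y) h + inner y (shiftl h)).
  assert (Hc : Rabs c <= 2 * norm2 y * norm2 h).
  { unfold c. eapply Rle_trans; [apply Rabs_triang | lra]. }
  assert (Ha : Rabs (2 * inner y h) <= 2 * norm2 y * norm2 h).
  { rewrite Rabs_mult, (Rabs_pos_eq 2) by lra. lra. }
  pose proof (quotient_remainder _ _ _ _ _ _ _ n0 n10 m0 T1 T2 E Ha Cy Hc Ch) as Q1.
  pose proof (cutoff_remainder _ _ _ _ _ _ n0 n10 m0 T1 T2 E Ha L1 L2 L3) as Q2.
  change (vadd y h O) with (y O + h O).
  apply Rabs_le_between in Q1, Q2.
  set (p := norm2 y ^ 2) in *. set (p1 := norm2 (vadd y h) ^ 2) in *.
  assert (Hp : 0 <= p) by apply pow2_ge_0.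
  replace (16 * corr y / (1 + p) ^ 2) with (8 * (2 * (corr y / (1 + p) ^ 2))) by (field; lra).
  replace (corr y * (2 * inner y h) / (1 + p) ^ 2)
    with (2 * (corr y / (1 + p) ^ 2) * inner y h) in Q1 by (field; lra).
  replace (c / (1 + p)) with (/ (1 + p) * c) in Q1 by (field; lra).
  replace (8 / (1 + p) * c) with (8 * (/ (1 + p) * c)) by (field; lra).
  apply Rabs_le. lra.
Qed.

(** The quotient is at most 1 because [corr] is at most the squared norm, and the cutoff term is at
    most 1 because it lives in the unit ball; [8 + / 4] is rounded up to 9. *)
Lemma rolle_close y : l2 y -> Rabs (rolle y - norm2 y ^ 2) <= 9.
Proof.
  intros Hy. unfold rolle.
  pose proof (corr_le y Hy) as Cy. pose proof (Rabs_coord0_le y Hy) as L.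
  pose proof (norm2_nonneg y) as n0. set (n := norm2 y) in *.
  assert (Hp : 0 <= n ^ 2) by apply pow2_ge_0.
  assert (B1 : Rabs (corr y / (1 + n ^ 2)) <= 1).
  { unfold Rdiv. rewrite Rabs_mult, (Rabs_pos_eq (/ (1 + n ^ 2)))
      by (left; apply Rinv_0_lt_compat; lra).
    apply Rmult_le_reg_r with (1 + n ^ 2); [lra |].
    rewrite Rmult_assoc, Rinv_l by lra. lra. }
  assert (B2 : Rabs (cut (n ^ 2) ^ 2 * y O) <= 1).
  { destruct (Rle_or_lt 1 n) as [Hn | Hn].
    - replace (cut (n ^ 2)) with 0 by (unfold cut; rewrite Rmax_left; nra).
      rewrite pow_ne_zero, Rmult_0_l, Rabs_R0 by lia. lra.
    - assert (0 <= cut (n ^ 2) <= 1) by (unfold cut; rewrite Rmax_right; nra).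
      rewrite Rabs_mult, (Rabs_pos_eq (cut (n ^ 2) ^ 2)) by apply pow2_ge_0.
      rewrite <- (Rmult_1_r 1). apply Rmult_le_compat; try apply Rabs_pos; nra. }
  apply Rabs_le_between in B1, B2. apply Rabs_le. lra.
Qed.

(* The equation [Drolle y = 0] is a linear recurrence of order two, along which
   the quadratic form below is constant, hence zero for a sequence tending to 0. *)
Lemma recurrence_invariant (t : R) (y : nat -> R) :
  l2 y -> (forall j, y (S (S j)) = t * y (S j) - y j) ->
  y O ^ 2 + y 1%nat ^ 2 - t * (y O * y 1%nat) = 0.
Proof.
  intros Hy Hrec.
  set (I := fun j => y j ^ 2 + y (S j) ^ 2 - t * (y j * y (S j))).
  assert (Hconst : forall j, I j = I O).
  { induction j as [| j IH]; [reflexivity |].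
    rewrite <- IH. unfold I. rewrite Hrec. ring. }
  pose proof (l2_shiftl _ Hy) as Hs.
  assert (Hlim : is_lim_seq I 0).
  { apply ex_series_lim_0. unfold I.
    apply ex_series_Rminus; [apply ex_series_Rplus; assumption |].
    apply ex_series_Rscal. exact (l2_mul _ _ Hy Hs). }
  assert (Hlim' : is_lim_seq I (I O)).
  { apply is_lim_seq_ext with (fun _ => I O); [now intros n |]. apply is_lim_seq_const. }
  apply is_lim_seq_unique in Hlim, Hlim'. rewrite Hlim in Hlim'.
  injection Hlim' as E. exact (eq_sym E).
Qed.

(** If every coordinate vanished, those with [j >= 1] would give a recurrence with an invariant
    equal to 0. For norm at least 1 the equation at [j = 0] turns the invariant into [y O ^ 2]. For
    norm below 1 the invariant is a definite form, so [y O] and [y 1] vanish and the equation at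
    [j = 0] fails. *)
Lemma Drolle_nonzero y : l2 y -> exists j, Drolle y j <> 0.
Proof.
  intros Hy. apply not_all_not_ex. intros Hall.
  assert (HD : forall j, Drolle y j = 0) by (intros j; apply NNPP, Hall). clear Hall.
  pose proof (corr_le y Hy) as Cy. pose proof (Rabs_coord0_le y Hy) as L.
  pose proof (norm2_nonneg y) as n0.
  unfold Drolle, vadd, vscal in HD.
  set (n := norm2 y) in *.
  set (al := 2 + 16 * corr y / (1 + n ^ 2) ^ 2 + cut (n ^ 2) * y O) in *.
  set (ga := cut (n ^ 2) ^ 2 / 4) in *.
  set (q := 1 + n ^ 2) in *. assert (Hq : 0 < q) by (unfold q; nra).
  set (t := al * q / 8).
  assert (Hal : al = 8 / q * t) by (unfold t; field; lra).
  assert (Hrec : forall j, y (S (S j)) = t * y (S j) - y j).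
  { intros j. specialize (HD (S j)). unfold shiftl, shiftr, e0 in HD.
    rewrite Hal in HD.
    assert (Hz : 8 / q * (t * y (S j) - y (S (S j)) - y j) = 0) by lra.
    apply Rmult_integral in Hz. destruct Hz as [Hz | Hz]; [| lra].
    assert (0 < 8 / q) by (apply Rdiv_lt_0_compat; lra). lra. }
  pose proof (recurrence_invariant t y Hy Hrec) as Inv.
  specialize (HD O). unfold shiftl, shiftr, e0 in HD.
  assert (Hq8 : 0 < 8 / q) by (apply Rdiv_lt_0_compat; lra).
  destruct (Rle_or_lt 1 n) as [Hn | Hn].
  - assert (Hga : ga = 0) by (unfold ga, cut; rewrite Rmax_left by nra; field).
    assert (H1 : y 1%nat = t * y O).
    { rewrite Hal, Hga in HD.
      assert (Hz : 8 / q * (t * y O - y 1%nat) = 0) by lra.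
      apply Rmult_integral in Hz. destruct Hz; lra. }
    assert (H0 : y O = 0) by (rewrite H1 in Inv; apply Rsqr_0_uniq; unfold Rsqr; lra).
    assert (Hz : forall j, y j = 0 /\ y (S j) = 0).
    { induction j as [| j [IH1 IH2]]; [rewrite H1, H0; lra |].
      rewrite Hrec, IH1, IH2. lra. }
    assert (n = 0); [| lra].
    unfold n, norm2. rewrite (Series_ext _ (fun j => 0 * 0)).
    + rewrite Series_scal_l, Rmult_0_l. apply sqrt_0.
    + intros j. rewrite (proj1 (Hz j)). ring.
  - assert (Hcut : cut (n ^ 2) = 1 - n ^ 2) by (unfold cut; rewrite Rmax_right; nra).
    assert (Ht : Rabs t < 2).
    { unfold t, al. rewrite Hcut.
      set (s := (1 - n ^ 2) * y O).
      assert (Hs : Rabs s <= 1).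
      { unfold s. rewrite Rabs_mult, (Rabs_pos_eq (1 - n ^ 2)) by nra.
        rewrite <- (Rmult_1_r 1). apply Rmult_le_compat; try apply Rabs_pos; nra. }
      (* Hence [t * q <= 2 * (q - 1) + 3 * q ^ 2 / 8], which is below [2 * q] since [q < 2]; from
         below, [2 + s > 0] and [v * q >= - (q - 1)] suffice. *)
      replace ((2 + 16 * corr y / q ^ 2 + s) * q / 8)
        with (2 * (corr y / q) + (2 + s) * q / 8) by (field; lra).
      assert (Hc : corr y / q * q = corr y) by (field; lra).
      set (v := corr y / q) in *.
      apply Rabs_le_between in Hs, Cy.
      assert (Hq2 : q < 2) by (unfold q; nra).
      assert (Hn2 : n ^ 2 = q - 1) by (unfold q; ring). rewrite Hn2 in Cy.
      assert (- (q - 1) <= v * q <= q - 1) by lra.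
      apply Rabs_def1.
      - apply Rmult_lt_reg_r with q; [exact Hq |]. nra.
      - apply Rmult_lt_reg_r with q; [exact Hq |]. nra. }
    apply Rabs_def2 in Ht.
    assert (H0 : y O = 0 /\ y 1%nat = 0).
    (* Four times the invariant, diagonalised; both coefficients are positive. *)
    { assert (Inv' : (2 - t) * (y O + y 1%nat) ^ 2 + (2 + t) * (y O - y 1%nat) ^ 2 = 0) by lra.
      pose proof (pow2_ge_0 (y O + y 1%nat)). pose proof (pow2_ge_0 (y O - y 1%nat)).
      assert ((y O + y 1%nat) ^ 2 = 0) by nra. assert ((y O - y 1%nat) ^ 2 = 0) by nra.
      assert (y O + y 1%nat = 0) by (apply Rsqr_0_uniq; unfold Rsqr; lra).
      assert (y O - y 1%nat = 0) by (apply Rsqr_0_uniq; unfold Rsqr; lra). lra. }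
    (* The equation at [j = 0] now retains only the [e0] term, whose coefficient is nonzero inside
       the ball. *)
    destruct H0 as [H0 H1]. rewrite H0, H1 in HD.
    unfold ga in HD. rewrite Hcut in HD.
    assert (0 < (1 - n ^ 2) ^ 2) by (apply pow2_gt_0; nra). lra.
Qed.

(** * Splitting N into infinitely many blocks *)

Definition enc (k j : nat) : nat := Cantor.to_nat (k, j).
Definition row (n : nat) : nat := fst (Cantor.of_nat n).
Definition col (n : nat) : nat := snd (Cantor.of_nat n).

Lemma row_enc k j : row (enc k j) = k.
Proof. unfold row, enc. now rewrite Cantor.cancel_of_to. Qed.

Lemma col_enc k j : col (enc k j) = j.
Proof. unfold col, enc. now rewrite Cantor.cancel_of_to. Qed.

Lemma enc_row_col n : enc (row n) (col n) = n.
Proof. unfold enc, row, col. rewrite <- surjective_pairing. apply Cantor.cancel_to_of. Qed.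

(** Block [k] thus contains no index below [k]: this controls the tails of sums over blocks and
    forces nonzero coordinates at arbitrarily large indices. *)
Lemma le_enc k j : (k + j <= enc k j)%nat.
Proof. pose proof (Cantor.to_nat_non_decreasing k j). unfold enc. lia. Qed.

Lemma row_le n : (row n <= n)%nat.
Proof. pose proof (le_enc (row n) (col n)). rewrite enc_row_col in H. lia. Qed.

Lemma enc_increasing k j : (enc k j < enc k (S j))%nat.
Proof.
  unfold enc.
  pose proof (Cantor.to_nat_spec k j). pose proof (Cantor.to_nat_spec k (S j)).
  nia.
Qed.

Lemma enc_increasing' k i j : (i < j)%nat -> (enc k i < enc k j)%nat.
Proof.
  induction 1 as [| j Hij IH]; [apply enc_increasing |].
  pose proof (enc_increasing k j). lia.
Qed.

(** The entries of a block stay at their original indices, so that blocks can be added and compared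
    with the whole series before reindexing by [enc k]. *)
Definition mask (k : nat) (a : nat -> R) : nat -> R :=
  fun n => if Nat.eqb (row n) k then a n else 0.

Lemma sum_n_mask_gap (k : nat) (a : nat -> R) (N m : nat) :
  (N <= m)%nat -> (forall n, (N < n <= m)%nat -> row n <> k) ->
  sum_n (mask k a) m = sum_n (mask k a) N.
Proof.
  intros H. induction H as [| m H IH]; intros Hgap; [reflexivity |].
  rewrite sum_Sn, IH by (intros n Hn; apply Hgap; lia).
  unfold mask at 2. destruct (Nat.eqb_spec (row (S m)) k) as [E | E].
  - exfalso. apply (Hgap (S m)); [lia | exact E].
  - apply Rplus_0_r.
Qed.

(** Since [enc k] increases and enumerates exactly the indices of row [k], the masked sequence is
    zero between two consecutive codes. *)
Lemma sum_n_mask_enc (k : nat) (a : nat -> R) (J : nat) :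
  sum_n (mask k a) (enc k J) = sum_n (fun j => a (enc k j)) J.
Proof.
  assert (Hval : forall j, mask k a (enc k j) = a (enc k j)).
  { intros j. unfold mask. now rewrite row_enc, Nat.eqb_refl. }
  assert (Hrow : forall n, row n = k -> exists j, n = enc k j).
  { intros n Hn. exists (col n). now rewrite <- Hn, enc_row_col. }
  induction J as [| J IH].
  - rewrite sum_O, <- Hval.
    destruct (enc k 0) as [| m] eqn:E; [now rewrite sum_O |].
    rewrite sum_Sn.
    assert (Z : forall n, (n <= m)%nat -> mask k a n = 0).
    { intros n Hn. unfold mask. destruct (Nat.eqb_spec (row n) k) as [F | F]; [| reflexivity].
      destruct (Hrow n F) as [j ->]. destruct j as [| j]; [lia |].
      pose proof (enc_increasing' k 0 (S j)). lia. }
    rewrite (sum_n_ext_loc _ (fun _ => 0) m Z).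
    unfold sum_n. rewrite sum_n_m_const. unfold plus; simpl. ring.
  - rewrite sum_Sn, <- IH, <- Hval.
    pose proof (enc_increasing k J) as Hlt.
    destruct (enc k (S J)) as [| m] eqn:E; [lia |].
    rewrite sum_Sn. f_equal.
    apply sum_n_mask_gap; [lia |].
    intros n Hn F. destruct (Hrow n F) as [j ->].
    destruct (Nat.lt_ge_cases J j) as [G | G].
    + destruct (Nat.eq_dec j (S J)) as [-> | G']; [lia |].
      pose proof (enc_increasing' k (S J) j). lia.
    + destruct (Nat.eq_dec j J) as [-> | G']; [lia |].
      pose proof (enc_increasing' k j J). lia.
Qed.

Lemma ex_series_mask (k : nat) (a : nat -> R) :
  ex_series (fun n => Rabs (a n)) -> ex_series (mask k a).
Proof.
  apply ex_series_dominated. intros n. unfold mask.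
  destruct (Nat.eqb _ _); [lra | rewrite Rabs_R0; apply Rabs_pos].
Qed.

(** The partial sums over the block form a subsequence of those of the masked series, which
    converges by absolute summability. *)
Lemma is_series_block (k : nat) (a : nat -> R) :
  ex_series (fun n => Rabs (a n)) ->
  is_series (fun j => a (enc k j)) (Series (mask k a)).
Proof.
  intros Ha.
  change (is_lim_seq (sum_n (fun j => a (enc k j))) (Series (mask k a))).
  apply is_lim_seq_ext with (fun J => sum_n (mask k a) (enc k J)).
  { intros J. apply sum_n_mask_enc. }
  apply is_lim_seq_subseq with (u := sum_n (mask k a)).
  - apply eventually_subseq. apply enc_increasing.
  - exact (Series_correct _ (ex_series_mask k a Ha)).
Qed.

Lemma sum_n_Series_mask (a : nat -> R) (K : nat) :
  ex_series (fun n => Rabs (a n)) ->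
  is_series (fun n => if Nat.leb (row n) K then a n else 0)
            (sum_n (fun k => Series (mask k a)) K).
Proof.
  intros Ha. induction K as [| K IH].
  - rewrite sum_O.
    apply is_series_ext with (mask 0 a).
    + intros n. unfold mask. now destruct (row n).
    + apply Series_correct, ex_series_mask, Ha.
  - rewrite sum_Sn.
    apply is_series_ext with (fun n => (if Nat.leb (row n) K then a n else 0) + mask (S K) a n).
    + intros n. unfold mask.
      destruct (Nat.leb_spec (row n) K), (Nat.leb_spec (row n) (S K)),
        (Nat.eqb_spec (row n) (S K)); try lia; simpl; ring.
    + exact (is_series_plus _ _ _ _ IH (Series_correct _ (ex_series_mask _ _ Ha))).
Qed.

(** The blocks [0] to [K] contain all indices up to [K], by [row_le]. What they miss of the series
    is therefore at most the tail [T K] of the absolute series. *)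
Lemma is_series_blocks (a : nat -> R) :
  ex_series (fun n => Rabs (a n)) ->
  is_series (fun k => Series (fun j => a (enc k j))) (Series a).
Proof.
  intros Ha.
  apply is_series_ext with (fun k => Series (mask k a)).
  { intros k. symmetry. apply is_series_unique, is_series_block, Ha. }
  change (is_lim_seq (sum_n (fun k => Series (mask k a))) (Series a)).
  set (T := fun K : nat => Series (fun n => Rabs (a n)) - sum_n (fun n => Rabs (a n)) K).
  assert (HT : is_lim_seq T 0).
  { replace (Finite 0) with (Rbar_minus (Series (fun n => Rabs (a n)))
                                        (Series (fun n => Rabs (a n))))
      by (simpl; f_equal; ring).
    apply is_lim_seq_minus'; [apply is_lim_seq_const |].
    exact (Series_correct _ Ha). }
  apply is_lim_seq_ext with
    (fun K => Series a - (Series a - sum_n (fun k => Series (mask k a)) K)).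
  { intros K. ring. }
  replace (Finite (Series a)) with (Rbar_minus (Series a) 0) by (simpl; f_equal; ring).
  apply is_lim_seq_minus'; [apply is_lim_seq_const |].
  apply is_lim_seq_abs_0.
  apply is_lim_seq_le_le with (u := fun _ => 0) (w := T);
    [| apply is_lim_seq_const | exact HT].
  intros K. split; [apply Rabs_pos |].
  pose proof (sum_n_Series_mask a K Ha) as HK.
  rewrite <- (is_series_unique _ _ HK).
  rewrite <- Series_minus; [| now apply ex_series_Rabs | eexists; exact HK].
  unfold T.
  pose proof (is_series_truncate (fun n => Rabs (a n)) K) as Hfin.
  rewrite <- (is_series_unique _ _ Hfin).
  rewrite <- Series_minus; [| exact Ha | eexists; exact Hfin].
  apply Series_Rabs_le.
  - intros n. pose proof (row_le n).
    destruct (Nat.leb_spec (row n) K), (Nat.leb_spec n K); try lia;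
      unfold Rminus; rewrite ?Rplus_opp_r, ?Rabs_R0, ?Ropp_0, ?Rplus_0_r;
      try apply Rabs_pos; lra.
  - apply ex_series_Rminus; [exact Ha | eexists; exact Hfin].
Qed.

(** * Gluing rescaled copies of [rolle] over the blocks *)

Definition blk (k : nat) (x : nat -> R) : nat -> R := fun j => x (enc k j).
Definition scale (mu : R) (k : nat) : R := mu * (/ 2) ^ k.
Definition piece (mu : R) (k : nat) (x : nat -> R) : R :=
  scale mu k ^ 2 * rolle (vscal (/ scale mu k) (blk k x)).
Definition glue (mu : R) (x : nat -> R) : R := Series (fun k => piece mu k x).
(** By the chain rule [c ^ 2 * rolle (x / c)] has gradient [c * Drolle (x / c)]. The blocks are
    assembled coordinatewise into a plain sequence, whose square summability is a separate
    matter. *)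
Definition Dglue (mu : R) (x : nat -> R) : nat -> R :=
  fun n => scale mu (row n) * Drolle (vscal (/ scale mu (row n)) (blk (row n) x)) (col n).

Lemma scale_pos mu k : 0 < mu -> 0 < scale mu k.
Proof. intros Hmu. apply Rmult_lt_0_compat; [exact Hmu | apply pow_lt; lra]. Qed.

Lemma is_series_scale_sq mu : is_series (fun k => scale mu k ^ 2) (mu ^ 2 * (4 / 3)).
Proof.
  apply is_series_ext with (fun k => mu ^ 2 * (/ 4) ^ k).
  - intros k. unfold scale. rewrite Rpow_mult_distr, <- pow_mult, (Nat.mul_comm k), pow_mult.
    do 2 f_equal. simpl. field.
  - replace (mu ^ 2 * (4 / 3)) with (mu ^ 2 * (/ (1 - / 4))) by field.
    assert (G : is_series (fun k => (/ 4) ^ k) (/ (1 - / 4))).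
    { apply is_series_geom. rewrite Rabs_pos_eq; lra. }
    exact (is_series_scal (mu ^ 2) _ _ G).
Qed.

Lemma is_series_inner_blk (x y : nat -> R) :
  ex_series (fun n => Rabs (x n * y n)) ->
  is_series (fun k => inner (blk k x) (blk k y)) (inner x y).
Proof. exact (is_series_blocks (fun n => x n * y n)). Qed.

Lemma l2_blk k x : l2 x -> l2 (blk k x).
Proof.
  intros Hx. eexists. apply (is_series_block k (fun n => x n ^ 2)).
  apply ex_series_ext with (fun n => x n ^ 2); [| exact Hx].
  intros n. symmetry. apply Rabs_pos_eq, pow2_ge_0.
Qed.

Lemma is_series_norm2_blk x : l2 x -> is_series (fun k => norm2 (blk k x) ^ 2) (norm2 x ^ 2).
Proof.
  intros Hx. rewrite norm2_sq by exact Hx.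
  apply is_series_ext with (fun k => inner (blk k x) (blk k x)).
  - intros k. symmetry. now apply norm2_sq, l2_blk.
  - now apply is_series_inner_blk, l2_mul_abs.
Qed.

Lemma norm2_vscal_inv_sq c x : 0 < c -> c ^ 2 * norm2 (vscal (/ c) x) ^ 2 = norm2 x ^ 2.
Proof.
  intros Hc. rewrite norm2_vscal, Rpow_mult_distr, pow2_abs. field. lra.
Qed.

Lemma piece_close mu k x : 0 < mu -> l2 x ->
  Rabs (piece mu k x - norm2 (blk k x) ^ 2) <= 9 * scale mu k ^ 2.
Proof.
  intros Hmu Hx. pose proof (scale_pos mu k Hmu) as Hc. unfold piece.
  rewrite <- (norm2_vscal_inv_sq (scale mu k) (blk k x)) by exact Hc.
  rewrite <- Rmult_minus_distr_l, Rabs_mult, Rabs_pos_eq by apply pow2_ge_0.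
  rewrite Rmult_comm. apply Rmult_le_compat_r; [apply pow2_ge_0 |].
  now apply rolle_close, l2_vscal, l2_blk.
Qed.

Lemma ex_series_piece mu x : 0 < mu -> l2 x -> ex_series (fun k => piece mu k x).
Proof.
  intros Hmu Hx.
  apply ex_series_ext with
    (fun k => (piece mu k x - norm2 (blk k x) ^ 2) + norm2 (blk k x) ^ 2).
  { intros k. simpl. ring. }
  apply ex_series_Rplus; [| eexists; now apply is_series_norm2_blk].
  apply ex_series_dominated with (fun k => 9 * scale mu k ^ 2).
  - intros k. now apply piece_close.
  - apply ex_series_Rscal. eexists. apply is_series_scale_sq.
Qed.

Lemma glue_close mu x : 0 < mu -> l2 x -> Rabs (glue mu x - norm2 x ^ 2) <= 12 * mu ^ 2.
Proof.
  intros Hmu Hx. unfold glue.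
  rewrite <- (is_series_unique _ _ (is_series_norm2_blk x Hx)).
  rewrite <- Series_minus
    by (now apply ex_series_piece || (eexists; now apply is_series_norm2_blk)).
  (* [12 = 9 * (4 / 3)], from the geometric sum of the squared scales. *)
  replace (12 * mu ^ 2) with (Series (fun k => 9 * scale mu k ^ 2)).
  - apply Series_Rabs_le; [intros k; now apply piece_close |].
    apply ex_series_Rscal. eexists. apply is_series_scale_sq.
  - rewrite Series_scal_l, (is_series_unique _ _ (is_series_scale_sq mu)). field.
Qed.

Lemma blk_Dglue mu k x :
  blk k (Dglue mu x) = vscal (scale mu k) (Drolle (vscal (/ scale mu k) (blk k x))).
Proof.
  apply functional_extensionality. intros j. unfold blk at 1, Dglue, vscal at 1.
  now rewrite row_enc, col_enc.
Qed.

Lemma vscal_vadd c x y : vscal c (vadd x y) = vadd (vscal c x) (vscal c y).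
Proof. apply functional_extensionality; intros n. unfold vscal, vadd. ring. Qed.

(** The outer factor [c ^ 2] cancels the inner scaling of [h], so the constant 61 is the same for
    all blocks and the estimates can be summed. *)
Lemma piece_remainder mu k x h : 0 < mu -> l2 x -> l2 h ->
  Rabs (piece mu k (vadd x h) - piece mu k x - inner (blk k (Dglue mu x)) (blk k h))
  <= 61 * norm2 (blk k h) ^ 2.
Proof.
  intros Hmu Hx Hh. pose proof (scale_pos mu k Hmu) as Hc.
  rewrite blk_Dglue, inner_vscall. unfold piece.
  change (blk k (vadd x h)) with (vadd (blk k x) (blk k h)). rewrite vscal_vadd.
  set (c := scale mu k) in *.
  set (x' := vscal (/ c) (blk k x)). set (h' := vscal (/ c) (blk k h)).
  assert (Hx' : l2 x') by now apply l2_vscal, l2_blk.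
  assert (Hh' : l2 h') by now apply l2_vscal, l2_blk.
  assert (E : inner (Drolle x') (blk k h) = c * inner (Drolle x') h').
  { unfold h'. rewrite inner_vscalr. field. lra. }
  rewrite E, <- (norm2_vscal_inv_sq c (blk k h)) by exact Hc. fold h'.
  replace (c ^ 2 * rolle (vadd x' h') - c ^ 2 * rolle x' - c * (c * inner (Drolle x') h'))
    with (c ^ 2 * (rolle (vadd x' h') - rolle x' - inner (Drolle x') h')) by ring.
  rewrite Rabs_mult, Rabs_pos_eq by apply pow2_ge_0.
  replace (61 * (c ^ 2 * norm2 h' ^ 2)) with (c ^ 2 * (61 * norm2 h' ^ 2)) by ring.
  apply Rmult_le_compat_l; [apply pow2_ge_0 |].
  now apply rolle_quadratic_approx.
Qed.

(** Summability of the pairing with [h] is assumed in place of [l2 (Dglue mu x)]: the latter is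
    deduced from this very estimate through [nonneg_gradient_bound]. *)
Lemma glue_remainder mu x h : 0 < mu -> l2 x -> l2 h ->
  ex_series (fun n => Rabs (Dglue mu x n * h n)) ->
  Rabs (glue mu (vadd x h) - glue mu x - inner (Dglue mu x) h) <= 61 * norm2 h ^ 2.
Proof.
  intros Hmu Hx Hh Hex. unfold glue.
  pose proof (is_series_inner_blk _ _ Hex) as Hin.
  rewrite <- (is_series_unique _ _ Hin).
  pose proof (ex_series_piece mu _ Hmu (l2_vadd _ _ Hx Hh)) as H1.
  pose proof (ex_series_piece mu _ Hmu Hx) as H2.
  rewrite <- Series_minus by assumption.
  rewrite <- Series_minus
    by (now apply ex_series_Rminus || (eexists; exact Hin)).
  rewrite <- (is_series_unique _ _ (is_series_norm2_blk h Hh)), <- Series_scal_l.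
  apply Series_Rabs_le; [intros k; now apply piece_remainder |].
  apply ex_series_Rscal. eexists. now apply is_series_norm2_blk.
Qed.

Lemma Dglue_nonzero mu x N : 0 < mu -> l2 x -> exists n, (N <= n)%nat /\ Dglue mu x n <> 0.
Proof.
  intros Hmu Hx. pose proof (scale_pos mu N Hmu) as Hc.
  destruct (Drolle_nonzero (vscal (/ scale mu N) (blk N x))) as [j Hj].
  { now apply l2_vscal, l2_blk. }
  exists (enc N j). split; [pose proof (le_enc N j); lia |].
  unfold Dglue. rewrite row_enc, col_enc.
  apply Rmult_integral_contrapositive. split; [lra | exact Hj].
Qed.

(** * The norm, the cone and the bump *)

Lemma quadratic_approx_C1 f D M : quadratic_approx f D M -> C1_with_deriv f D.
Proof.
  intros H. split; [intros x Hx; now apply quadratic_approx_frechet with M |].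
  intros x Hx eps Heps. pose proof (proj1 H) as HM.
  exists (eps / (6 * M + 1)). split; [apply Rdiv_lt_0_compat; lra |].
  intros y Hy Hyx.
  eapply Rle_lt_trans; [now apply (quadratic_approx_lipschitz_map f D M) |].
  pose proof (norm2_nonneg (vsub y x)).
  apply Rmult_lt_compat_r with (r := 6 * M + 1) in Hyx; [| lra].
  replace (eps / (6 * M + 1) * (6 * M + 1)) with eps in Hyx by (field; lra).
  lra.
Qed.

(** Any ball contains two finitely supported sequences that differ at coordinate 0. Both in the
    cone, they would both be zero. *)
Lemma empty_interior_cone (D : (nat -> R) -> nat -> R) :
  (forall x, l2 x -> (forall N, exists n, (N <= n)%nat /\ D x n <> 0) \/
                     (forall n, D x n = 0)) ->
  empty_interior (cone D).
Proof.
  intros HD z [Hz [r [Hr Hball]]].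
  (* If [lam] and [D x] were nonzero, a nonzero coordinate of [D x] beyond [N] would survive in
     [y]. *)
  assert (Hfin : forall y N, cone D y -> (forall n, (N < n)%nat -> y n = 0) ->
                   forall n, y n = 0).
  { intros y N [lam [x [Hlam [Hx Hy]]]] HN n. rewrite Hy. unfold vscal.
    destruct (HD x Hx) as [Hinf | H0]; [| rewrite H0; ring].
    destruct (Hinf (S N)) as [m [Hm HDm]].
    specialize (HN m Hm). rewrite Hy in HN. unfold vscal in HN.
    apply Rmult_integral in HN. destruct HN as [-> | HN]; [ring | contradiction]. }
  set (a := fun n => z n ^ 2).
  assert (Hlim : is_lim_seq (sum_n a) (Series a)) by exact (Series_correct _ Hz).
  apply is_lim_seq_spec in Hlim.
  assert (Hr2 : 0 < (r / 2) ^ 2) by (apply pow2_gt_0; lra).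
  destruct (Hlim (mkposreal _ Hr2)) as [N HN]. specialize (HN N (le_n N)). simpl in HN.
  set (t := fun n => if Nat.leb n N then z n else 0).
  assert (Ht2 : is_series (fun n => t n ^ 2) (sum_n a N)).
  { apply is_series_ext with (fun n => if Nat.leb n N then a n else 0);
      [| apply is_series_truncate].
    intros n. unfold t, a. destruct (Nat.leb n N); simpl; ring. }
  assert (Lt : l2 t) by (eexists; exact Ht2).
  assert (Htz : norm2 (vsub t z) < r / 2).
  { apply Rsqr_incrst_0; [| apply norm2_nonneg | lra].
    rewrite !Rsqr_pow2. rewrite norm2_sq by now apply l2_vsub.
    replace (inner (vsub t z) (vsub t z)) with (Series a - sum_n a N).
    - apply Rabs_lt_between in HN. lra.
    - rewrite <- (is_series_unique _ _ Ht2).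
      rewrite <- Series_minus by assumption.
      apply Series_ext. intros n. unfold vsub, a, t. destruct (Nat.leb n N); ring. }
  assert (Ne0 : norm2 e0 = 1).
  { rewrite <- sqrt_1. unfold norm2. f_equal.
    rewrite (Series_ext _ (fun n => e0 n * e0 n)) by (intros n; ring).
    exact (inner_e0 e0 l2_e0). }
  (* The truncation [t] is within [r / 2] of [z], so this second point still lies in the ball. *)
  set (t' := vadd t (vscal (r / 2) e0)).
  assert (Lt' : l2 t') by (now apply l2_vadd, l2_vscal, l2_e0).
  assert (C1 : cone D t) by (apply Hball; [exact Lt | lra]).
  assert (C2 : cone D t').
  { apply Hball; [exact Lt' |].
    replace (vsub t' z) with (vadd (vsub t z) (vscal (r / 2) e0))
      by (apply functional_extensionality; intros n; unfold t', vadd, vsub; ring).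
    eapply Rle_lt_trans;
      [apply norm2_triangle; [now apply l2_vsub | apply l2_vscal, l2_e0] |].
    rewrite norm2_vscal, Ne0, Rabs_pos_eq; lra. }
  assert (Z : forall n, (N < n)%nat -> t n = 0).
  { intros n Hn. unfold t. destruct (Nat.leb_spec n N); [lia | reflexivity]. }
  pose proof (Hfin t N C1 Z O) as E1.
  assert (E2 : t' O = 0).
  { apply (Hfin t' N C2). intros n Hn. unfold t', vadd, vscal. rewrite Z by exact Hn.
    destruct n; [lia | simpl; ring]. }
  unfold t', vadd, vscal, e0 in E2. lra.
Qed.

(** The function is the square root of [glue] plus a constant. The constant keeps the radicand away
    from 0, and the gradient stays a positive multiple of [Dglue]. *)
Lemma norm_approximation (delta : R) : 0 < delta ->
  exists psi D M K,
    quadratic_approx psi D M /\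
    (forall x y, l2 x -> l2 y -> Rabs (psi x - psi y) <= K * norm2 (vsub x y)) /\
    (forall x, l2 x -> 0 < psi x /\ Rabs (psi x - norm2 x) <= delta) /\
    (forall x N, l2 x -> exists n, (N <= n)%nat /\ D x n <> 0).
Proof.
  (* The square root will exceed the norm by at most [6 * mu]. *)
  intros Hdelta. set (mu := delta / 6). assert (Hmu : 0 < mu) by (unfold mu; lra).
  (* Twice the error [12 * mu ^ 2] of [glue_close], which leaves a positive lower bound. *)
  set (u := fun x => glue mu x + 24 * mu ^ 2).
  assert (Hu : forall x, l2 x -> norm2 x ^ 2 + 12 * mu ^ 2 <= u x <= norm2 x ^ 2 + 36 * mu ^ 2).
  { intros x Hx. pose proof (glue_close mu x Hmu Hx) as H.
    apply Rabs_le_between in H. unfold u. lra. }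
  assert (Hmu2 : 0 < mu ^ 2) by (apply pow2_gt_0; lra).
  assert (Hu0 : forall x, l2 x -> 0 <= u x).
  { intros x Hx. pose proof (Hu x Hx). pose proof (pow2_ge_0 (norm2 x)). lra. }
  assert (Hrem : forall x h, l2 x -> l2 h ->
            ex_series (fun n => Rabs (Dglue mu x n * h n)) ->
            Rabs (u (vadd x h) - u x - inner (Dglue mu x) h) <= 61 * norm2 h ^ 2).
  { intros x h Hx Hh Hex. unfold u.
    replace (glue mu (vadd x h) + 24 * mu ^ 2 - (glue mu x + 24 * mu ^ 2))
      with (glue mu (vadd x h) - glue mu x) by ring.
    now apply glue_remainder. }
  (* Square summability of [Dglue mu x] is obtained here from the nonnegativity of [u]. *)
  assert (HD : forall x, l2 x -> l2 (Dglue mu x) /\ norm2 (Dglue mu x) ^ 2 <= 4 * 61 * u x).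
  { intros x Hx. apply nonneg_gradient_bound; [lra | exact Hx | exact Hu0 |].
    intros h Hh Hex. pose proof (Hrem x h Hx Hh Hex) as H.
    apply Rabs_le_between in H. lra. }
  set (psi := fun x => sqrt (u x)).
  assert (Hpsi2 : forall x, l2 x -> psi x ^ 2 = u x).
  { intros x Hx. apply pow2_sqrt, Hu0, Hx. }
  assert (Hpsi0 : forall x, 0 <= psi x) by (intros x; apply sqrt_pos).
  (* Square roots of the bounds on [u]: [3 ^ 2 <= 12] and [6 ^ 2 = 36]. *)
  assert (Hpsin : forall x, l2 x -> norm2 x <= psi x <= norm2 x + 6 * mu /\ 3 * mu <= psi x).
  { intros x Hx. pose proof (Hu x Hx) as H. rewrite <- Hpsi2 in H by exact Hx.
    pose proof (Hpsi0 x). pose proof (norm2_nonneg x). pose proof (pow2_ge_0 (norm2 x)).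
    repeat split; (apply Rsqr_incr_0_var; [unfold Rsqr; nra | lra]). }
  assert (Hinc : forall x h, l2 x -> l2 h ->
            Rabs (psi (vadd x h) - psi x) <= 77 * norm2 h).
  { intros x h Hx Hh. pose proof (l2_vadd _ _ Hx Hh) as Hxh.
    destruct (HD x Hx) as [LD ND].
    pose proof (Hrem x h Hx Hh (l2_mul_abs _ _ LD Hh)) as R.
    pose proof (cauchy_schwarz _ h LD Hh) as CS.
    destruct (Hpsin x Hx) as [[P1 _] P2]. destruct (Hpsin _ Hxh) as [[P3 _] P4].
    rewrite <- Hpsi2 in ND by exact Hx. rewrite <- !Hpsi2 in R by assumption.
    pose proof (norm2_vsub_le (vadd x h) x Hxh Hx) as T. rewrite vsub_vadd_cancel in T.
    pose proof (norm2_nonneg h) as Nh. pose proof (norm2_nonneg (Dglue mu x)) as NN.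
    (* [4 * 61 = 244] lies below [16 ^ 2]. *)
    assert (ND' : norm2 (Dglue mu x) <= 16 * psi x).
    { apply Rsqr_incr_0_var; [unfold Rsqr; nra | lra]. }
    set (s := psi x) in *. set (s1 := psi (vadd x h)) in *. set (m := norm2 h) in *.
    assert (Hin : Rabs (inner (Dglue mu x) h) <= 16 * s * m).
    { eapply Rle_trans; [exact CS | now apply Rmult_le_compat_r]. }
    (* Since [m <= s1 + s], the remainder [61 * m ^ 2] is absorbed into [61 * m * (s1 + s)]; with 16
       from the gradient this gives 77. *)
    assert (B : Rabs ((s1 - s) * (s1 + s)) <= 77 * m * (s1 + s)).
    { apply Rabs_le_between in R, Hin. assert (m * m <= m * (s1 + s)) by nra.
      assert (0 <= m * s1) by nra.
      apply Rabs_le. nra. }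
    rewrite Rabs_mult, (Rabs_pos_eq (s1 + s)) in B by lra.
    apply Rmult_le_reg_r with (s1 + s); [lra | exact B]. }
  exists psi, (fun x => vscal (/ (2 * psi x)) (Dglue mu x)),
    ((61 + 77 ^ 2) / (6 * mu)), 77.
  split; [split |].
  - left. apply Rdiv_lt_0_compat; lra.
  - intros x Hx. destruct (HD x Hx) as [LD _]. split; [now apply l2_vscal |].
    intros h Hh. pose proof (l2_vadd _ _ Hx Hh) as Hxh.
    pose proof (Hrem x h Hx Hh (l2_mul_abs _ _ LD Hh)) as R.
    pose proof (Hinc x h Hx Hh) as I.
    destruct (Hpsin x Hx) as [_ P].
    rewrite <- !Hpsi2 in R by assumption. rewrite inner_vscall.
    set (s := psi x) in *. set (s1 := psi (vadd x h)) in *.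
    set (g := inner (Dglue mu x) h) in *.
    (* The numerator is the remainder of [u] minus the squared increment of [psi], and
       [2 * s >= 6 * mu]; this yields the constant [M]. *)
    replace (s1 - s - / (2 * s) * g)
      with ((s1 ^ 2 - s ^ 2 - g - (s1 - s) ^ 2) / (2 * s)) by (field; lra).
    assert (I2 : (s1 - s) ^ 2 <= 77 ^ 2 * norm2 h ^ 2).
    { rewrite <- (pow2_abs (s1 - s)), <- Rpow_mult_distr.
      apply pow_incr. split; [apply Rabs_pos | exact I]. }
    pose proof (pow2_ge_0 (s1 - s)) as I3.
    unfold Rdiv. rewrite Rabs_mult, (Rabs_pos_eq (/ (2 * s)))
      by (left; apply Rinv_0_lt_compat; lra).
    replace ((61 + 77 ^ 2) * / (6 * mu) * norm2 h ^ 2)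
      with ((61 + 77 ^ 2) * norm2 h ^ 2 * / (6 * mu)) by ring.
    apply Rmult_le_compat; [apply Rabs_pos | left; apply Rinv_0_lt_compat; lra | |].
    + apply Rabs_le_between in R. apply Rabs_le. lra.
    + apply Rinv_le_contravar; lra.
  - split; [| split].
    + intros x y Hx Hy. rewrite <- (vadd_vsub y x) at 1. apply Hinc; [exact Hy |].
      now apply l2_vsub.
    + intros x Hx. destruct (Hpsin x Hx) as [P1 P2]. split; [lra |].
      apply Rabs_le. unfold mu in P1. lra.
    + intros x N Hx. destruct (Dglue_nonzero mu x N Hmu Hx) as [n [Hn Hne]].
      exists n. split; [exact Hn |]. destruct (Hpsin x Hx) as [_ P].
      apply Rmult_integral_contrapositive. split; [| exact Hne].
      apply Rinv_neq_0_compat. lra.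
Qed.

(** * Truncating the approximate norm to a bump *)

Lemma square_cut_increment (s t : R) :
  Rabs (cut t ^ 2 - cut s ^ 2 - - 2 * cut s * (t - s)) <= (t - s) ^ 2.
Proof.
  unfold cut.
  (* The derivative [- 2 * cut] of [cut ^ 2] is Lipschitz with constant 2, hence the remainder; the
     cases follow the sides of 1 on which [s] and [t] lie. *)
  destruct (Rle_or_lt 0 (1 - t)) as [Ht | Ht], (Rle_or_lt 0 (1 - s)) as [Hs | Hs];
    [rewrite !Rmax_right by lra | rewrite Rmax_right, Rmax_left by lra
    | rewrite Rmax_left, Rmax_right by lra | rewrite !Rmax_left by lra];
    apply Rabs_le; pose proof (pow2_ge_0 (t - s)).
  - lra.
  - assert (0 <= (1 - t) * (s - 1)) by (apply Rmult_le_pos; lra).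
    pose proof (pow2_ge_0 (1 - s)). pose proof (pow2_ge_0 (1 - t)). lra.
  - assert (0 <= (1 - s) * (t - 1)) by (apply Rmult_le_pos; lra).
    pose proof (pow2_ge_0 (1 - s)). pose proof (pow2_ge_0 (1 - t)). lra.
  - lra.
Qed.

Lemma square_cut_lipschitz (s t : R) : 0 <= s -> 0 <= t ->
  Rabs (cut t ^ 2 - cut s ^ 2) <= 2 * Rabs (t - s).
Proof.
  intros Hs Ht.
  assert (H : forall a, 0 <= a -> 0 <= cut a <= 1).
  { intros a Ha. unfold cut, Rmax. destruct (Rle_dec 0 (1 - a)); lra. }
  replace (cut t ^ 2 - cut s ^ 2) with ((cut t + cut s) * (cut t - cut s)) by ring.
  pose proof (H s Hs). pose proof (H t Ht).
  rewrite Rabs_mult, Rabs_pos_eq by lra.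
  apply Rmult_le_compat; [lra | apply Rabs_pos | lra |].
  unfold cut, Rmax. destruct (Rle_dec 0 (1 - t)), (Rle_dec 0 (1 - s));
    apply Rabs_le; unfold Rabs; destruct (Rcase_abs (t - s)); lra.
Qed.

(** A short step along the gradient gains a first order amount. For the bump this excludes
    [psi x = 1] at interior points of the support. *)
Lemma gradient_increase f D M x eps :
  quadratic_approx f D M -> l2 x -> (exists n, D x n <> 0) -> 0 < eps ->
  exists y, l2 y /\ norm2 (vsub y x) < eps /\ f x < f y.
Proof.
  intros [HM H] Hx [n Hn] Heps. destruct (H x Hx) as [LD Hq].
  assert (Hpos : 0 < norm2 (D x)).
  { destruct (norm2_nonneg (D x)) as [| E]; [assumption | exfalso].
    assert (Hs : sum_n (fun k => D x k ^ 2) n <= Series (fun k => D x k ^ 2)).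
    { apply sum_n_le_Series; [intros k; apply pow2_ge_0 | exact LD]. }
    assert (Hs' : Series (fun k => D x k ^ 2) = 0).
    { symmetry in E. apply sqrt_eq_0 in E; [exact E |].
      apply Series_nonneg; [intros k; apply pow2_ge_0 | exact LD]. }
    assert (Hn2 : 0 < D x n ^ 2) by now apply pow2_gt_0.
    assert (D x n ^ 2 <= sum_n (fun k => D x k ^ 2) n); [| lra].
    destruct n as [| n]; [rewrite sum_O; lra |].
    rewrite sum_Sn.
    assert (0 <= sum_n (fun k => D x k ^ 2) n).
    { rewrite sum_n_Reals. apply cond_pos_sum. intros k. apply pow2_ge_0. }
    unfold plus; simpl in *. lra. }
  set (m := norm2 (D x)) in *.
  (* The first bound makes the quadratic loss at most half the linear gain; the second keeps the
     step within [eps / 2]. *)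
  set (t := Rmin (/ (2 * (M + 1))) (eps / (2 * m))).
  assert (Ht : 0 < t).
  { apply Rmin_pos; [apply Rinv_0_lt_compat; lra | apply Rdiv_lt_0_compat; lra]. }
  assert (Ht1 : t * (2 * (M + 1)) <= 1).
  { apply Rle_trans with (/ (2 * (M + 1)) * (2 * (M + 1))).
    - apply Rmult_le_compat_r; [lra | apply Rmin_l].
    - rewrite Rinv_l; lra. }
  assert (Ht2 : t * m <= eps / 2).
  { apply Rle_trans with (eps / (2 * m) * m).
    - apply Rmult_le_compat_r; [lra | apply Rmin_r].
    - right. field. lra. }
  assert (Lh : l2 (vscal t (D x))) by now apply l2_vscal.
  exists (vadd x (vscal t (D x))).
  split; [now apply l2_vadd |].
  assert (Nh : norm2 (vscal t (D x)) = t * m).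
  { rewrite norm2_vscal, Rabs_pos_eq; [reflexivity | lra]. }
  rewrite vsub_vadd_cancel, Nh. split; [lra |].
  specialize (Hq _ Lh). rewrite Nh, inner_vscalr, <- norm2_sq in Hq by exact LD.
  fold m in Hq. apply Rabs_le_between in Hq.
  assert (0 < t * m ^ 2) by (apply Rmult_lt_0_compat; [lra | apply pow2_gt_0; lra]).
  assert (M * (t * m) ^ 2 <= t * m ^ 2 / 2); [| lra].
  replace (M * (t * m) ^ 2) with (M * t * (t * m ^ 2)) by ring. nra.
Qed.

(** Serves to pass from [psi < 1] where the bump is nonzero to [psi <= 1] on its support. *)
Lemma lipschitz_closure (f : (nat -> R) -> R) (K c : R) (S : (nat -> R) -> Prop) x :
  (forall x y, l2 x -> l2 y -> Rabs (f x - f y) <= K * norm2 (vsub x y)) ->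
  (forall y, l2 y -> S y -> f y <= c) -> l2_closure S x -> f x <= c.
Proof.
  intros HK HS [Hx Hcl]. apply le_epsilon. intros eps Heps.
  pose proof (Rabs_pos K).
  (* The sign of [K] is not given, hence [Rabs K]. *)
  destruct (Hcl (eps / (Rabs K + 1))) as [z [Hz [HSz Hzx]]];
    [apply Rdiv_lt_0_compat; lra |].
  pose proof (HS z Hz HSz). pose proof (HK x z Hx Hz) as HKx.
  rewrite norm2_vsub_sym in HKx.
  assert (Hb : K * norm2 (vsub z x) <= eps).
  { pose proof (norm2_nonneg (vsub z x)). pose proof (Rle_abs K).
    apply Rmult_lt_compat_r with (r := Rabs K + 1) in Hzx; [| lra].
    replace (eps / (Rabs K + 1) * (Rabs K + 1)) with eps in Hzx by (field; lra). nra. }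
  apply Rabs_le_between in HKx. lra.
Qed.

Lemma norm2_vzero : norm2 vzero = 0.
Proof.
  unfold norm2, vzero. rewrite (Series_ext _ (fun _ => 0 * 0)) by (intros n; ring).
  rewrite Series_scal_l, Rmult_0_l. apply sqrt_0.
Qed.

Lemma l2_vzero : l2 vzero.
Proof.
  replace vzero with (vscal 0 e0); [apply l2_vscal, l2_e0 |].
  apply functional_extensionality; intros n. unfold vscal, vzero. ring.
Qed.

Lemma bump_exists :
  exists (b : (nat -> R) -> R) (Db : (nat -> R) -> (nat -> R)),
    C1_with_deriv b Db /\ lipschitz_fun b /\ lipschitz_map Db /\ is_bump b /\
    empty_interior (cone Db) /\
    (forall x, l2_interior (support b) x -> exists n, Db x n <> 0).
Proof.
  (* With error [/ 2], [psi] is below 1 at the origin, and [psi <= 1] forces norm at most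
     [3 / 2]. *)
  destruct (norm_approximation (/ 2)) as [psi [D [M [K [HT [HL [Hpsi Hinf]]]]]]]; [lra |].
  pose proof HT as [HM HT'].
  set (b := fun x => cut (psi x) ^ 2).
  set (Db := fun x => vscal (- 2 * cut (psi x)) (D x)).
  assert (Hcut : forall x, l2 x -> 0 <= cut (psi x) <= 1).
  { intros x Hx. pose proof (proj1 (Hpsi x Hx)). unfold cut, Rmax.
    destruct (Rle_dec 0 (1 - psi x)); lra. }
  assert (Hcut0 : forall x, cut (psi x) <> 0 -> psi x < 1).
  { intros x Hx. apply Rnot_le_lt. intros F. apply Hx. unfold cut. apply Rmax_left. lra. }
  (* [2 * M] comes from the remainder of [psi] times [2 * cut <= 2], and [K ^ 2] from the squared
     increment of [psi]. *)
  assert (HQ : quadratic_approx b Db (2 * M + K ^ 2)).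
  { split; [pose proof (pow2_ge_0 K); lra |].
    intros x Hx. destruct (HT' x Hx) as [LD HQ]. split; [now apply l2_vscal |].
    intros h Hh. specialize (HQ h Hh). pose proof (l2_vadd _ _ Hx Hh) as Hxh.
    pose proof (square_cut_increment (psi x) (psi (vadd x h))) as S1.
    pose proof (HL (vadd x h) x Hxh Hx) as S2. rewrite vsub_vadd_cancel in S2.
    assert (S3 : (psi (vadd x h) - psi x) ^ 2 <= K ^ 2 * norm2 h ^ 2).
    { rewrite <- pow2_abs, <- Rpow_mult_distr. apply pow_incr.
      split; [apply Rabs_pos | exact S2]. }
    unfold b, Db. rewrite inner_vscall.
    pose proof (Hcut x Hx) as Hc. set (c := cut (psi x)) in *.
    set (e := psi (vadd x h) - psi x) in *. set (g := inner (D x) h) in *.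
    assert (S4 : Rabs (2 * c * (e - g)) <= 2 * (M * norm2 h ^ 2)).
    { rewrite Rabs_mult, Rabs_pos_eq by lra.
      apply Rmult_le_compat; [lra | apply Rabs_pos | lra | exact HQ]. }
    apply Rabs_le_between in S1, S4. apply Rabs_le. lra. }
  assert (Hsupp : forall x, support b x -> psi x <= 1).
  { intros x. apply lipschitz_closure with K; [exact HL |].
    intros y Hy [_ Hby]. left. apply Hcut0. intros E. apply Hby. unfold b. rewrite E. ring. }
  exists b, Db. refine (conj _ (conj _ (conj _ (conj (conj _ _) (conj _ _))))).
  - exact (quadratic_approx_C1 _ _ _ HQ).
  - exists (2 * K). intros x y Hx Hy.
    eapply Rle_trans; [apply square_cut_lipschitz; left; now apply Hpsi |].
    pose proof (HL x y Hx Hy). lra.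
  - exists (6 * (2 * M + K ^ 2)). intros x y Hx Hy.
    now apply (quadratic_approx_lipschitz_map b Db).
  - exists vzero. split; [apply l2_vzero |].
    pose proof (proj2 (Hpsi vzero l2_vzero)) as P. rewrite norm2_vzero in P.
    apply Rabs_le_between in P. unfold b, cut. rewrite Rmax_right by lra.
    apply pow_nonzero. lra.
  - exists 2. intros x Hsx. pose proof (Hsupp x Hsx).
    pose proof (proj2 (Hpsi x (proj1 Hsx))) as P. apply Rabs_le_between in P. lra.
  - apply empty_interior_cone. intros x Hx.
    (* Either the truncation makes the whole gradient vanish, or [Db x] is a nonzero multiple of
       [D x]. *)
    destruct (Req_dec (cut (psi x)) 0) as [E | E].
    + right. intros n. unfold Db, vscal. rewrite E. ring.
    + left. intros N. destruct (Hinf x N Hx) as [n [Hn HDn]]. exists n. split; [exact Hn |].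
      apply Rmult_integral_contrapositive. split; [lra | exact HDn].
  (* Some [y] in the ball has [psi x < psi y <= 1], so [cut (psi x)] is strictly positive. *)
  - intros x [Hx [r [Hr Hball]]].
    destruct (Hinf x O Hx) as [n [_ HDn]].
    destruct (gradient_increase psi D M x r HT Hx (ex_intro _ n HDn) Hr)
      as [y [Hy [Hyx Hlt]]].
    pose proof (Hsupp y (Hball y Hy Hyx)).
    exists n. apply Rmult_integral_contrapositive. split; [| exact HDn].
    unfold cut. rewrite Rmax_right; lra.
Qed.

Theorem theorem4p3 :
  (forall delta : R, 0 < delta ->
     exists (psi : (nat -> R) -> R) (Dpsi : (nat -> R) -> (nat -> R)),
       C1_with_deriv psi Dpsi /\
       lipschitz_fun psi /\
       lipschitz_map Dpsi /\
       (forall x, l2 x -> Rabs (psi x - norm2 x) <= delta) /\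
       (forall x, l2 x -> exists n, Dpsi x n <> 0) /\
       empty_interior (cone Dpsi))
  /\
  (exists (b : (nat -> R) -> R) (Db : (nat -> R) -> (nat -> R)),
       C1_with_deriv b Db /\
       lipschitz_fun b /\
       lipschitz_map Db /\
       is_bump b /\
       empty_interior (cone Db) /\
       (forall x, l2_interior (support b) x -> exists n, Db x n <> 0)).
Proof.
  split; [| exact bump_exists].
  intros delta Hdelta.
  destruct (norm_approximation delta Hdelta) as [psi [D [M [K [HT [HL [Hpsi Hinf]]]]]]].
  exists psi, D. refine (conj _ (conj _ (conj _ (conj _ (conj _ _))))).
  - exact (quadratic_approx_C1 _ _ _ HT).
  - exists K. exact HL.
  - exists (6 * M). intros x y Hx Hy. now apply (quadratic_approx_lipschitz_map psi D).
  - intros x Hx. now apply Hpsi.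
  - intros x Hx. destruct (Hinf x O Hx) as [n [_ Hn]]. now exists n.
  - apply empty_interior_cone. intros x Hx. left. intros N. now apply Hinf.
Qed.
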